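(* Let $\Omega \subset \mathbb{R}^n$, $n\geq 2$, be a bounded, smooth, strongly convex domain. Let $T>0$, $a\colon \Omega \times (0,T] \to \mathbb{R}$, $u_0\in C^1(\overline{\Omega})$ with $u_0=0$ on $\partial\Omega$, and let $u \in C^2_x(\Omega) \cap C^1(\overline{\Omega}\times[0,T])$ be a positive solution of $$\begin{cases} u_t - \Delta u = a(x,t) u & \text{in } \Omega \times (0,T], \\ u=0 & \text{on }\partial \Omega\times [0,T], \\ D_x u \cdot \nu >0 & \text{on }\partial \Omega\times [0,T], \\ u =u_0 & \text{on } \overline{\Omega} \times \{0\}, \end{cases}$$ where $\nu$ is the interior normal to $\partial \Omega$. Assume moreover that $u_0$ is $\log$-concave. Then $$\inf_{\Omega \times \Omega \times [0,1] \times [0,T]} \mathcal{C}^*_{\log(u)} \geq -e\, T \sup_{\Omega \times \Omega \times [0,1] \times (0,T]} \left(\mathcal{C}^*_{a}\right)^-.$$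
   Context: For a function $w(x,t)$, $x_1,x_3\in\Omega$, $\lambda\in[0,1]$, put $x_2=\lambda x_3+(1-\lambda)x_1$ and $$\mathcal{C}^*_w(x_1,x_3,\lambda,t):=w(x_2,t)-\lambda w(x_3,t)-(1-\lambda)w(x_1,t).$$ $g^-:=\max\{0,-g\}$. Domains $\Omega$ are open. Smooth means $\partial\Omega\in C^{2,\alpha}$; strongly convex means that the second fundamental form of $\partial\Omega$ with respect to its interior normal is positive definite everywhere. A solution is positive when $u>0$ in $\Omega\times(0,T]$. $D_x$ is the spatial gradient. $u\in C^2_x(\Omega)$ means $u(\cdot,t)\in C^2(\Omega)$ for each $t\in(0,T]$. A function $w$ is $\log$-concave if $w>0$ (in $\Omega$) and $\log(w)$ is concave. *)

(* Defs.v *)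
From HB Require Import structures.
From mathcomp Require Import all_boot all_order all_algebra.
From mathcomp Require Import all_classical all_reals all_analysis.
Import Order.TTheory GRing.Theory Num.Theory.
Import numFieldNormedType.Exports.

Set Implicit Arguments.
Unset Strict Implicit.
Unset Printing Implicit Defensive.

Local Open Scope classical_set_scope.
Local Open Scope ring_scope.

(* The library norm on 'rV[R]_n is the sup norm (same topology); the Euclidean
   structure is introduced here. *)
Definition dotv {R : realType} {n : nat} (v w : 'rV[R]_n) : R :=
  \sum_(i < n) v 0 i * w 0 i.

Definition enorm {R : realType} {n : nat} (v : 'rV[R]_n) : R :=
  Num.sqrt (dotv v v).

Definition partial {R : realType} {n : nat} (i : 'I_n) (f : 'rV[R]_n -> R) :
  'rV[R]_n -> R := fun x => 'D_(delta_mx 0 i) f x.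

Definition grad {R : realType} {n : nat} (f : 'rV[R]_n -> R) (x : 'rV[R]_n) :
  'rV[R]_n := \row_(i < n) partial i f x.

Definition laplacian {R : realType} {n : nat} (f : 'rV[R]_n -> R)
  (x : 'rV[R]_n) : R := \sum_(i < n) partial i (partial i f) x.

(* Classes C^1(A) and C^2(A), used for open A only. *)
Definition C1_on {R : realType} {n : nat} (A : set 'rV[R]_n)
    (f : 'rV[R]_n -> R) : Prop :=
  forall x, A x -> {for x, continuous f} /\
    forall i, derivable f x (delta_mx 0 i) /\
              {for x, continuous (partial i f)}.

Definition C2_on {R : realType} {n : nat} (A : set 'rV[R]_n)
    (f : 'rV[R]_n -> R) : Prop :=
  C1_on A f /\ forall i, C1_on A (partial i f).

Definition C2alpha_on {R : realType} {n : nat} (alpha : R)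
    (A : set 'rV[R]_n) (f : 'rV[R]_n -> R) : Prop :=
  C2_on A f /\
  exists H : R, forall (i j : 'I_n) (x y : 'rV[R]_n), A x -> A y ->
    `|partial i (partial j f) x - partial i (partial j f) y|
      <= H * enorm (x - y) `^ alpha.

Definition boundary {R : realType} {n : nat} (A : set 'rV[R]_n) :
  set 'rV[R]_n := closure A `\` interior A.

Definition domain {R : realType} {n : nat} (Omega : set 'rV[R]_n) : Prop :=
  [/\ open Omega, connected Omega & Omega !=set0].

(* Up to relabelling and reorienting the coordinate axes, Omega is near p the
   strict epigraph of a C^{2,alpha} function g of the n-1 coordinates other
   than x_i; rho is the corresponding local defining function, positive inside
   Omega.  The balls are those of the sup norm, so that col' i maps ball p r
   onto ball (col' i p) r. *)
Definition boundary_chart {R : realType} {n : nat} (alpha : R)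
    (Omega : set 'rV[R]_n) (p : 'rV[R]_n) (rho : 'rV[R]_n -> R) : Prop :=
  exists (i : 'I_n) (b : bool) (g : 'rV[R]_n.-1 -> R) (r : R),
    [/\ 0 < r,
        C2alpha_on alpha (ball (col' i p) r) g,
        rho = (fun x => (-1) ^+ b * x 0 i - g (col' i x)) &
        forall x : 'rV[R]_n, ball p r x -> (Omega x <-> 0 < rho x)].

Definition C2alpha_boundary {R : realType} {n : nat} (alpha : R)
    (Omega : set 'rV[R]_n) : Prop :=
  forall p, boundary Omega p -> exists rho, boundary_chart alpha Omega p rho.

Definition unit_grad {R : realType} {n : nat} (rho : 'rV[R]_n -> R)
    (x : 'rV[R]_n) : 'rV[R]_n := (enorm (grad rho x))^-1 *: grad rho x.

(* On the boundary, unit_grad rho is the interior unit normal, whatever the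
   chart. *)
Definition interior_unit_normal {R : realType} {n : nat} (alpha : R)
    (Omega : set 'rV[R]_n) (p nu : 'rV[R]_n) : Prop :=
  exists2 rho, boundary_chart alpha Omega p rho & nu = unit_grad rho p.

(* Second fundamental form with respect to the interior normal N = unit_grad rho:
   II_p(v, w) = - <D_v N (p), w> for v, w tangent at p; it is positive definite
   for a ball. *)
Definition second_fundamental_form {R : realType} {n : nat}
    (rho : 'rV[R]_n -> R) (p v w : 'rV[R]_n) : R :=
  - dotv ('D_v (unit_grad rho) p) w.

Definition strongly_convex {R : realType} {n : nat} (alpha : R)
    (Omega : set 'rV[R]_n) : Prop :=
  forall p rho, boundary Omega p -> boundary_chart alpha Omega p rho ->
  forall v : 'rV[R]_n, dotv v (unit_grad rho p) = 0 -> v != 0 ->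
    0 < second_fundamental_form rho p v v.

(* C^1 up to the boundary: the function and its first derivatives in the
   interior extend continuously to the closure. *)
Definition C1_closure {R : realType} {n : nat} (Omega : set 'rV[R]_n)
    (f : 'rV[R]_n -> R) : Prop :=
  {within closure Omega, continuous f} /\
  exists2 Df : 'rV[R]_n -> 'rV[R]_n,
    {within closure Omega, continuous Df} &
    forall (x : 'rV[R]_n) (i : 'I_n), Omega x -> is_derive x (delta_mx 0 i) f (Df x 0 i).

(* The same on closure Omega x [0, T].  Du and ut are the (unique) continuous
   extensions to closure Omega x [0, T] of the spatial gradient and of the time
   derivative of u, which give meaning to D_x u on the lateral boundary and to
   u_t at t = T. *)
Definition C1_closed_cylinder {R : realType} {n : nat} (Omega : set 'rV[R]_n)
    (T : R) (u : 'rV[R]_n -> R -> R) (Du : 'rV[R]_n -> R -> 'rV[R]_n)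
    (ut : 'rV[R]_n -> R -> R) : Prop :=
  [/\ {within closure Omega `*` `[0, T], continuous (fun z : 'rV[R]_n * R => u z.1 z.2)},
      {within closure Omega `*` `[0, T], continuous (fun z : 'rV[R]_n * R => Du z.1 z.2)},
      {within closure Omega `*` `[0, T], continuous (fun z : 'rV[R]_n * R => ut z.1 z.2)} &
      forall (x : 'rV[R]_n) (t : R), Omega x -> 0 < t < T ->
        (forall i, is_derive x (delta_mx 0 i) (u ^~ t) (Du x t 0 i)) /\
        is_derive t 1 (u x) (ut x t)].

Definition log_concave {R : realType} {n : nat} (Omega : set 'rV[R]_n)
    (w : 'rV[R]_n -> R) : Prop :=
  (forall x : 'rV[R]_n, Omega x -> 0 < w x) /\
  convex_function Omega (fun x => - ln (w x)).

Definition Cstar {R : realType} {n : nat} (w : 'rV[R]_n -> R -> R)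
    (x1 x3 : 'rV[R]_n) (lambda t : R) : R :=
  let x2 := lambda *: x3 + (1 - lambda) *: x1 in
  w x2 t - lambda * w x3 t - (1 - lambda) * w x1 t.

Definition neg_part {R : realType} (g : R) : R := Num.max 0 (- g).

(* Main.v *)
(* The logarithm v of u satisfies v_t = Lap v + |Dv|^2 + a.  For a
   fixed lambda in (0, 1), let S be the supremum of the negative part of C*_a and
   k > S.  If C*_v + k t attains a minimum over x1, x3 in Omega and t <= t0 < T at an
   interior point with t > 0, then Dv takes the same value at x1, x2 and x3, so
   the terms |Dv|^2 cancel, and the time derivative of C*_v is at least
   C*_a >= - S, which contradicts the minimality in t.  Hence C*_v >= - S t, which
   is stronger than the bound with the factor e.

   A negative minimum is attained because C*_v has nonnegative lower limits at the
   boundary.  If x1 <> x3, strict convexity puts x2 inside Omega while v tends to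
   - oo at the boundary.  If x1 and x3 tend to the same boundary point p, then
   u(x) = s D_x u(xi) . nu(p), where s is the length of the chord from x to the
   boundary in the direction - nu(p); s is concave in x and D_x u . nu(p) is
   continuous up to the boundary and positive at p.  No second derivatives at
   the boundary are involved.

   Omega is convex because u0 is log-concave and vanishes on the boundary: a chord
   cannot leave Omega, as - log u0 would blow up at the exit point. *)
Require Import Defs.
From HB Require Import structures.
From mathcomp Require Import all_boot all_order all_algebra.
From mathcomp Require Import all_classical all_reals all_analysis.
From mathcomp Require Import ring lra.
Import Order.TTheory GRing.Theory Num.Theory.
Import numFieldNormedType.Exports.
Local Open Scope classical_set_scope.
Local Open Scope ring_scope.

Set Implicit Arguments.
Unset Strict Implicit.
Unset Printing Implicit Defensive.

(** * Derivatives along lines and minima *)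

Lemma is_derive_line (R : realType) (V W : normedModType R) (f : V -> W)
    (x v : V) (h : R) (d : W) :
  is_derive (x + h *: v) v f d -> is_derive h 1 (fun s => f (x + s *: v)) d.
Proof.
move=> [dx xd].
have E : (fun k : R => k^-1 *:
    (((fun s : R => f (x + s *: v)) \o shift h) (k *: 1) - f (x + h *: v))) =
  (fun k => k^-1 *: ((f \o shift (x + h *: v)) (k *: v) - f (x + h *: v))).
  apply/funext => k /=; congr (_ *: (f _ - _)).
  by rewrite scalerDl [k *: 1]mulr1 addrCA addrA.
by split; rewrite /derivable /derive E.
Qed.

Lemma is_derive_cvgP (R : realType) (V W : normedModType R) (f : V -> W) (x v : V) (l : W) :
  is_derive x v f l <-> h^-1 *: (f (x + h *: v) - f x) @[h --> 0^'] --> l.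
Proof.
have E : (fun h : R => h^-1 *: ((f \o shift x) (h *: v) - f x)) =
    (fun h => h^-1 *: (f (x + h *: v) - f x)).
  by apply/funext => h /=; rewrite [_ *: _ + x]addrC.
split=> [[dx <-]|fl]; first by rewrite /derive -E; exact: dx.
by split; [apply/cvg_ex; exists l; rewrite E|rewrite /derive E; exact: cvg_lim].
Qed.

(** The intermediate point is a fraction [th] of [b], so that one statement covers increments of
    either sign; for [b = 0] any fraction would do. *)
Lemma is_derive1_MVT (R : realType) (g dg : R -> R) (b : R) :
  (forall s : R, `|s| <= `|b| -> is_derive s 1 g (dg s)) ->
  exists2 th, 0 < th < 1 & g b - g 0 = dg (th * b) * b.
Proof.
move=> gd.
have gc (s : R) : `|s| <= `|b| -> {for s, continuous g}.
  by move=> /gd [gs _]; apply: differentiable_continuous; apply/derivable1_diffP.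
have [b0|b0|->] := ltgtP b 0; last first.
- by exists 2^-1; rewrite ?subrr ?mulr0// invr_gt0 ltr0n invf_lt1 ?ltr1n.
- have sb (s : R) : 0 <= s <= b -> `|s| <= `|b|.
    by move=> /andP[s0 sb]; rewrite !ger0_norm// ltW.
  have [|||c] := @MVT R g dg 0 b => //.
  + move=> s; rewrite in_itv/= => /andP[s0 s1]; apply: gd.
    by apply: sb; rewrite !ltW.
  + apply: continuous_in_subspaceT => s; rewrite inE/= in_itv/= => sI.
    exact/gc/sb.
  + rewrite in_itv/= => /andP[c0 c1] ->; exists (c / b).
      by rewrite divr_gt0// ltr_pdivrMr// mul1r.
    by rewrite subr0 divfK// gt_eqF.
- have sb (s : R) : b <= s <= 0 -> `|s| <= `|b|.
    by move=> /andP[s0 sb]; rewrite !ler0_norm// ?lerN2// ltW.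
  have [|||c] := @MVT R g dg b 0 => //.
  + move=> s; rewrite in_itv/= => /andP[s0 s1]; apply: gd.
    by apply: sb; rewrite !ltW.
  + apply: continuous_in_subspaceT => s; rewrite inE/= in_itv/= => sI.
    exact/gc/sb.
  + rewrite in_itv/= => /andP[c0 c1] gE; exists (c / b).
      rewrite ltr_ndivrMr// mul1r c0 andbT.
      by rewrite -mulrNN -invrN divr_gt0 ?oppr_gt0.
    by rewrite -opprB gE sub0r mulrN opprK divfK// lt_eqF.
Qed.

(** The difference quotients with [h < 0] are nonpositive. The one-sided form is what the time
    variable requires, since the minimum is compared with earlier times only. *)
Lemma is_derive_left_min (R : realType) (f : R -> R) (t l : R) :
  is_derive t 1 f l -> (\forall s \near t, s < t -> f t <= f s) -> l <= 0.
Proof.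
move=> /is_derive_cvgP /cvg_dnbhs_at_left fl mf.
apply: (@cvgr_to_le _ (0:R)^'- _ _ _ _ _ fl).
have tm : t + h @[h --> (0:R)^'-] --> t.
  rewrite -[X in _ --> X]addr0; apply: cvgD; first exact: cvg_cst.
  by apply: cvg_at_left_filter; exact: cvg_id.
have {}mf := tm _ mf.
near=> h.
have h0 : h < 0 by near: h; exact: nbhs_left_lt.
have : t + h < t -> f t <= f (t + h) by near: h; exact: mf.
rewrite gtrDl => /(_ h0) ftf.
by rewrite [h *: 1]mulr1 [_ *: _]mulrC nmulr_lle0 ?subr_ge0// invr_lt0.
Unshelve. all: by end_near. Qed.

(** The step along [w + c *: e] is taken first along [w], then along [e]. By the mean value theorem
    the second increment is a multiple of ['D_e f] at a nearby point, and ['D_e f] is continuous at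
    [x]. *)
Lemma is_derive_add_dir (R : realType) (V : normedModType R) (f : V -> R)
    (x w e : V) (c d : R) :
  is_derive x w f d -> (\forall y \near x, derivable f y e) ->
  {for x, continuous ('D_e f)} -> is_derive x (w + c *: e) f (d + c * 'D_e f x).
Proof.
move=> /is_derive_cvgP fw fe ce; apply/is_derive_cvgP.
have -> : (fun h : R => h^-1 *: (f (x + h *: (w + c *: e)) - f x)) =
    (fun h => h^-1 *: (f (x + h *: w) - f x) +
              h^-1 *: (f (x + h *: w + (h * c) *: e) - f (x + h *: w))).
  apply/funext => h; rewrite -[RHS]scalerDr [h *: (w + _)]scalerDr scalerA addrA.
  by congr (_ *: _); rewrite [RHS]addrC addrA subrK.
apply: cvgD => //; apply/cvgrPdist_le => eps eps0.
(* The [+ 1] keeps the divisor positive when [c = 0]. *)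
have c1 : 0 < `|c| + 1 by rewrite ltr_wpDl.
have /cvgrPdist_le/(_ (eps / (`|c| + 1)))/= := ce.
rewrite divr_gt0// => /(_ isT) ce'.
have /nbhs_ballP[r /= r0 rP] : \forall y \near x, derivable f y e /\
    `|'D_e f x - 'D_e f y| <= eps / (`|c| + 1).
  exact: filterI.
have M0 : 0 < `|w| + `|c| * `|e| + 1 by rewrite ltr_wpDl// addr_ge0// mulr_ge0.
near=> h.
have h0 : h != 0 by near: h; exact: nbhs_dnbhs_neq.
have hr : `|h| * (`|w| + `|c| * `|e| + 1) < r.
  rewrite -ltr_pdivlMr//; near: h; apply: dnbhs0_lt.
  by rewrite divr_gt0.
have inball s : `|s| <= `|h * c| -> ball x r (x + h *: w + s *: e).
  move=> sh; rewrite -ball_normE/= -addrA opprD addrA subrr sub0r normrN.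
  apply: le_lt_trans hr; apply: (le_trans (ler_normD _ _)).
  rewrite !normrZ !mulrDr -addrA lerD2l ler_wpDr ?mulr1//.
  by rewrite mulrA -normrM ler_wpM2r.
have [s|th /andP[th0 th1]] := @is_derive1_MVT R (fun s => f (x + h *: w + s *: e))
    (fun s => 'D_e f (x + h *: w + s *: e)) (h * c).
  by move=> /inball /rP[fs _]; apply: is_derive_line; apply: derivableP.
rewrite scale0r addr0 => ->.
rewrite (_ : _ *: (_ * (h * c)) = c * 'D_e f (x + h *: w + (th * (h * c)) *: e)).
  rewrite -mulrBr normrM.
  have /inball/rP[_] : `|th * (h * c)| <= `|h * c|.
    by rewrite normrM ler_piMl// ger0_norm ltW.
  rewrite ler_pdivlMr// => dle.
  by apply: le_trans dle; rewrite mulrC ler_wpM2l// lerDl.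
by rewrite /GRing.scale/=; field.
Unshelve. all: by end_near. Qed.

(** If no minimum existed, every point of [K] would have a neighbourhood on whose trace on [A] the
    function exceeds some [F w] with [w] in [A]. Compactness would then give a single [w] whose
    value lies strictly below all values on [A], including its own. *)
Lemma lsc_compact_min (X : topologicalType) (R : realType) (K A : set X) (F : X -> R) (z0 : X) :
  compact K -> A `<=` K -> A z0 ->
  (forall z, K z -> (\forall y \near z, A y -> F z0 < F y) \/
     (A z /\ forall e, 0 < e -> \forall y \near z, A y -> F z - e < F y)) ->
  exists2 z, A z & forall y, A y -> F z <= F y.
Proof.
move=> /compact_near_coveringP cK AK Az0 lscF; apply: contrapT => nomin.
have low z : A z -> exists2 y, A y & F y < F z.
  move=> Az; apply: contrapT => H; apply: nomin; exists z => // y Ay.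
  by rewrite leNgt; apply/negP => yz; apply: H; exists y.
(* The sublevel sets in [A] form a filter base; compactness is used as near covering with respect to
   this filter. *)
pose B (w : X) : set X := A `&` [set v | F v <= F w].
have FB : ProperFilter (filter_from A B).
  apply: filter_from_proper; last by move=> w Aw; exists w; split=> /=.
  apply: filter_from_filter; first by exists z0.
  move=> w w' Aw Aw'; have [ww'|ww'] := leP (F w) (F w').
    by exists w => // v [Av /= vw]; split; split=> //=; apply: le_trans ww'.
  by exists w' => // v [Av /= vw]; split; split=> //=; apply: (le_trans vw); apply: ltW.
have [w Aw] : \forall i \near (filter_from A B), K `<=` (fun y => A y -> F i < F y).
  apply: cK => z Kz.
  have [w Aw nw] : exists2 w, A w & \forall y \near z, A y -> F w < F y.
    have [|[Az]] := lscF z Kz; first by exists z0.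
    have [y Ay yz] := low z Az => /(_ (F z - F y)); rewrite subr_gt0 => /(_ yz).
    by rewrite opprB addrCA subrr addr0; exists y.
  exists ([set y | A y -> F w < F y], B w); first by split => //=; exists w.
  by move=> [y i] /= [wy [Ai iw]] Ay; apply: (le_lt_trans iw); exact: wy.
have Bw : B w w by split=> /=.
by move=> /(_ w Bw w (AK _ Aw) Aw); rewrite ltxx.
Qed.

(** The direction is built up from the zero vector one coordinate at a time, and [is_derive_add_dir]
    absorbs each new coordinate by continuity of the corresponding partial derivative. *)
Lemma C1_on_is_derive (R : realType) (n : nat) (A : set 'rV[R]_n)
    (f : 'rV[R]_n -> R) (x v : 'rV[R]_n) :
  open A -> C1_on A f -> A x -> is_derive x v f (dotv (grad f x) v).
Proof.
move=> oA fA Ax.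
have fs (r : seq 'I_n) : is_derive x (\sum_(i <- r) v 0 i *: delta_mx 0 i) f
    (\sum_(i <- r) v 0 i * partial i f x).
  elim: r => [|i r IH]; first by rewrite !big_nil; exact: is_derive0.
  rewrite !big_cons addrC [X in is_derive _ _ _ X]addrC.
  apply: is_derive_add_dir => //; last by have [_ /(_ i)[]] := fA x Ax.
  near=> y; have Ay : A y by near: y; exact: open_nbhs_nbhs.
  by have [_ /(_ i)[]] := fA y Ay.
have := fs (index_enum 'I_n); rewrite -row_sum_delta.
suff -> : dotv (grad f x) v = \sum_i v 0 i * partial i f x by [].
by apply: eq_bigr => i _; rewrite mxE mulrC.
Unshelve. all: by end_near. Qed.

Lemma is_derive_right_min (R : realType) (f : R -> R) (t l : R) :
  is_derive t 1 f l -> (\forall s \near t, t < s -> f t <= f s) -> 0 <= l.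
Proof.
move=> /is_derive_cvgP /cvg_dnbhs_at_right fl mf.
apply: (@cvgr_to_ge _ (0:R)^'+ _ _ _ _ _ fl).
have tm : t + h @[h --> (0:R)^'+] --> t.
  rewrite -[X in _ --> X]addr0; apply: cvgD; first exact: cvg_cst.
  by apply: cvg_at_right_filter; exact: cvg_id.
have {}mf := tm _ mf.
near=> h.
have h0 : 0 < h by near: h; exact: nbhs_right_gt.
have : t < t + h -> f t <= f (t + h) by near: h; exact: mf.
rewrite ltrDl => /(_ h0) ftf.
by rewrite [h *: 1]mulr1 [_ *: _]mulrC pmulr_lge0 ?subr_ge0// invr_gt0.
Unshelve. all: by end_near. Qed.

Lemma is_derive_min (R : realType) (f : R -> R) (t l : R) :
  is_derive t 1 f l -> (\forall s \near t, f t <= f s) -> l = 0.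
Proof.
move=> fl fm; apply/eqP; rewrite eq_le; apply/andP; split.
  by apply: (is_derive_left_min fl); apply: filterS fm.
by apply: (is_derive_right_min fl); apply: filterS fm.
Qed.

(* Otherwise [f1] would be negative just after [0], and [f] would decrease there. *)
Lemma second_derive_min (R : realType) (f f1 : R -> R) (l : R) :
  (\forall s \near (0 : R), is_derive (s : R) 1 f (f1 s)) -> is_derive (0 : R) 1 f1 l ->
  (\forall s \near (0 : R), f 0 <= f s) -> 0 <= l.
Proof.
move=> fd f1l fm; rewrite leNgt; apply/negP => l0.
have f10 : f1 0 = 0 by apply: (is_derive_min (nbhs_singleton fd)).
move/is_derive_cvgP/cvg_dnbhs_at_right : f1l => /cvgr_lt/(_ _ l0).
rewrite near_withinE => f1n.
have /nbhs_ballP[r /= r0 rP] : \forall s \near (0 : R),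
    (0 < s -> s^-1 *: (f1 (0 + s *: 1) - f1 0) < 0) /\
    is_derive (s : R) 1 f (f1 s) /\ f 0 <= f s.
  by apply: filterI; last exact: filterI.
have inb s : `|s| <= r / 2 -> ball (0 : R) r s.
  by rewrite -ball_normE/= sub0r normrN => /le_lt_trans; apply; rewrite gtr_pMr// invf_lt1 ?ltr1n.
have r20 : 0 < r / 2 by rewrite divr_gt0.
have [s|th /andP[th0 th1] E] := @is_derive1_MVT _ f f1 (r / 2).
  by rewrite (ger0_norm (ltW r20)) => /inb/rP[_ []].
have /inb/rP[_ [_]] : `|r / 2| <= r / 2 by rewrite ger0_norm // ltW.
rewrite -subr_ge0 E pmulr_lge0//; apply/negP; rewrite -ltNge.
have thr : 0 < th * (r / 2) by rewrite mulr_gt0.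
have /inb/rP[/(_ thr)+ _] : `|th * (r / 2)| <= r / 2.
  by rewrite ger0_norm ?ler_piMl// ltW.
by rewrite f10 add0r subr0 [_ *: 1]mulr1 [_ *: _]mulrC pmulr_llt0// invr_gt0.
Qed.

(** * Convexity of the domain *)

Lemma convex_setP (R : realType) (M : lmodType R) (A : set M) :
  @convex_set R M A <-> forall x y (s : R), A x -> A y -> 0 <= s <= 1 ->
    A (s *: y + (1 - s) *: x).
Proof.
split=> [cA x y s Ax Ay /andP[s0 s1]|cA x y s].
  by have /set_mem := cA y x (Itv01 s0 s1) (mem_set Ay) (mem_set Ax).
rewrite !inE => Ax Ay; apply: cA => //.
by apply/andP; split; [exact: ge0|exact: le1].
Qed.

Lemma convex_functionE (R : realType) (M : lmodType R) (A : set M) (f : M -> R)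
    (x y : M) (s : R) :
  @convex_function R M A f -> A x -> A y -> 0 <= s <= 1 ->
  f (s *: y + (1 - s) *: x) <= s * f y + (1 - s) * f x.
Proof.
move=> cf Ax Ay /andP[s0 s1].
exact: (cf (Itv01 s0 s1) y x (mem_set Ay) (mem_set Ax)).
Qed.

Lemma continuous_segment (R : realType) (V : normedModType R) (x v : V) :
  continuous (fun s : R => x + s *: v).
Proof.
move=> s; apply: cvgD; first exact: cvg_cst.
by apply: cvgZr_tmp; exact: cvg_id.
Qed.

(** The exit parameter is the least element of the compact set of parameters in [[0, 1]] whose point
    is outside [A]. The points just before it lie in [A], which puts the exit point in the
    closure. *)
Lemma segment_exit (R : realType) (n : nat) (A : set 'rV[R]_n) (x y : 'rV[R]_n) :
  open A -> A x -> ~ A y ->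
  exists th : R, [/\ 0 < th <= 1, boundary A (x + th *: (y - x)) &
    forall s, 0 <= s < th -> A (x + s *: (y - x))].
Proof.
move=> oA Ax Ay.
pose K : set R := `[0, 1] `&` (fun s => x + s *: (y - x)) @^-1` ~` A.
have K1 : K 1.
  by split; rewrite /= ?in_itv/= ?ler01 ?lexx// scale1r addrCA subrr addr0.
have cK : compact K.
  apply: compact_closedI; first exact: segment_compact.
  by move/continuous_closedP: (@continuous_segment R _ x (y - x)); apply; exact: open_closedC.
have [th] := @compact_EVT_min R R id K (ex_intro _ 1 K1) cK (continuous_subspaceT (fun=> cvg_id)).

rewrite inE => -[/= + thA] thmin; rewrite in_itv/= => /andP[th0 th1].
have sA s : 0 <= s < th -> A (x + s *: (y - x)).
  move=> /andP[s0 sth]; apply: contrapT => sA.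
  suff : K s by move=> /mem_set/thmin; rewrite leNgt sth.
  by split=> //=; rewrite in_itv/= s0 (le_trans (ltW sth)).
have th00 : 0 < th.
  rewrite lt_neqAle th0 andbT; apply/eqP => th00; apply: thA.
  by rewrite -th00 scale0r addr0.
exists th; rewrite th00 th1; split=> //; split; last first.
  by rewrite ((interior_id A).1 oA).
move=> B /(@continuous_segment _ _ x (y - x) th _) /nbhs_ballP[r /= r0 rB].
pose s := Num.max 0 (th - r / 2).
have sth : s < th by rewrite gt_max th00 gtrBl divr_gt0.
have s0 : 0 <= s by rewrite le_max lexx.
exists (x + s *: (y - x)); split; first by apply: sA; rewrite s0.
apply: rB; rewrite -ball_normE/= ger0_norm ?subr_ge0 ?ltW//.
have : th - r / 2 <= s by rewrite le_max lexx orbT.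
by have : r / 2 < r by [rewrite gtr_pMr// invf_lt1 ?ltr1n]; lra.
Qed.

Lemma log_concave_convex (R : realType) (n : nat) (A : set 'rV[R]_n) (w : 'rV[R]_n -> R) :
  open A -> {within closure A, continuous w} ->
  (forall x, boundary A x -> w x = 0) -> log_concave A w -> @convex_set R _ A.
Proof.
move=> oA cw w0 [wp wc]; apply/convex_setP => x y s Ax Ay /andP[s0 s1].
apply: contrapT => Az.
have [th [/andP[th0 th1] bp inA]] := segment_exit oA Ax Az.
set z := s *: y + (1 - s) *: x in bp inA Az.
pose M := Num.max (- ln (w x)) (- ln (w y)).
(* The segment from [x] to [z] is part of the chord from [x] to [y], with parameter [t * s]. Before
   the exit log-concavity keeps [w] above a fixed positive number; at the exit [ln] takes a default
   value, so the contradiction is drawn from the left limit. *)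
have lb t : 0 <= t < th -> expR (- M) <= w (x + t *: (z - x)).
  move=> /[dup] /inA At /andP[t0 tth].
  have ts : 0 <= t * s <= 1.
    by rewrite mulr_ge0//= mulr_ile1// (le_trans (ltW tth)).
  rewrite -[leRHS]lnK ?posrE ?wp// ler_expR lerNl.
  have -> : x + t *: (z - x) = (t * s) *: y + (1 - t * s) *: x.
    by rewrite /z; apply/rowP => i; rewrite !mxE; ring.
  apply: (le_trans (convex_functionE wc Ax Ay ts)).
  rewrite [leRHS](_ : _ = t * s * M + (1 - t * s) * M); last by ring.
  case/andP: ts => ts0 ts1.
  by rewrite lerD// ler_wpM2l ?subr_ge0// le_max lexx ?orbT.
have cv : w @ within (closure A) (nbhs (x + th *: (z - x))) --> (0 : R).
  by rewrite -[X in _ --> X](w0 _ bp); exact: ((subspace_continuousP _ _).1 cw _ bp.1).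
have : w (x + t *: (z - x)) @[t --> th^'-] --> (0 : R).
  apply: cvg_trans cv => B /=; rewrite /within/= => nB.
  have nB' := @continuous_segment R _ x (z - x) th _ nB.
  suff : \forall t \near th^'-, B (w (x + t *: (z - x))) by [].
  near=> t.
  have tI : 0 <= t < th.
    by apply/andP; split; [near: t; exact: nbhs_left_ge|near: t; exact: nbhs_left_lt].
  suff : closure A (x + t *: (z - x)) -> B (w (x + t *: (z - x))).
    by apply; apply: subset_closure; exact: inA.
  by near: t; exact: (cvg_at_left_filter cvg_id nB').
move=> /cvgr_to_ge wge.
have : expR (- M) <= 0.
  apply: wge; near=> t; apply: lb.
  by apply/andP; split; [near: t; exact: nbhs_left_ge|near: t; exact: nbhs_left_lt].
by rewrite leNgt expR_gt0.
Unshelve. all: by end_near. Qed.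

(** The target point is kept fixed while [y] is replaced by a nearby [w] in [A]; the other endpoint
    then moves to [g w], which is close to [x] and hence still in [A]. *)
Lemma convex_open_closure (R : realType) (V : normedModType R) (A : set V) (x y : V) (s : R) :
  open A -> convex_set A -> A x -> closure A y -> 0 <= s < 1 ->
  A (s *: y + (1 - s) *: x).
Proof.
move=> oA /convex_setP cA Ax cAy /andP[s0 s1].
have s10 : 1 - s != 0 by rewrite subr_eq0 gt_eqF.
pose g w := (1 - s)^-1 *: (s *: y + (1 - s) *: x - s *: w).
have gE w : s *: w + (1 - s) *: g w = s *: y + (1 - s) *: x.
  by rewrite scalerA divff// scale1r addrC subrK.
have gy : g y = x by rewrite /g [_ + _ *: x]addrC addrK scalerA mulVf// scale1r.
have cg : {for y, continuous g}.
  apply: cvgZl_tmp; apply: cvgB; first exact: cvg_cst.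
  by apply: cvgZl_tmp; exact: cvg_id.
have [w [Aw gAw]] : A `&` g @^-1` A !=set0.
  by apply: cAy; apply: cg; rewrite gy; exact: open_nbhs_nbhs.
by rewrite -(gE w); apply: cA => //; rewrite s0 ltW.
Qed.

Lemma convex_closure (R : realType) (V : normedModType R) (A : set V) :
  convex_set A -> convex_set (closure A).
Proof.
move=> /convex_setP cA; apply/convex_setP => x y s cx cy s01 B nB.
have cf : {for (x, y), continuous (fun z : V * V => s *: z.2 + (1 - s) *: z.1)}.
  by apply: cvgD; apply: cvgZl_tmp; [exact: cvg_snd|exact: cvg_fst].
have [[U W] /= [nU nW] UW] := cf _ nB.
have [x' [Ax' Ux']] := cx _ nU.
have [y' [Ay' Wy']] := cy _ nW.
exists (s *: y' + (1 - s) *: x'); split; first exact: cA.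
exact: (UW (x', y')).
Qed.

(** * Local defining functions and strict convexity of the closure *)

Lemma boundary_chart_is_derive (R : realType) (n : nat) (alpha : R)
    (A : set 'rV[R]_n) (p : 'rV[R]_n) (rho : 'rV[R]_n -> R) :
  boundary_chart alpha A p rho ->
  \forall q \near p, [/\ A q <-> 0 < rho q, {for q, continuous rho} &
    forall v, is_derive q v rho (dotv (grad rho q) v)].
Proof.
move=> [i [b [g [r [r0 [[gC1 _] _] rhoE rhoA]]]]].
have inb q : ball p r q -> ball (col' i p) r (col' i q).
  by move=> [_ pq]; split=> // j k; rewrite !mxE; exact: pq.
have L q v : ball p r q ->
    is_derive q v rho ((-1) ^+ b * v 0 i - dotv (grad g (col' i q)) (col' i v)).
  move=> /inb bq; apply/is_derive_cvgP.
  have /is_derive_cvgP dg := C1_on_is_derive (col' i v) (ball_open (col' i p) r) gC1 bq.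
  rewrite rhoE.
  (* The factor [h^-1 * h] is left unsimplified so that the identity also holds at [h = 0], where
     the inverse is 0. *)
  have -> : (fun h => h^-1 *: ((-1) ^+ b * (q + h *: v) 0 i - g (col' i (q + h *: v)) -
      ((-1) ^+ b * q 0 i - g (col' i q)))) =
    (fun h : R => (h^-1 * h) * ((-1) ^+ b * v 0 i) -
      h^-1 *: (g (col' i q + h *: col' i v) - g (col' i q))).
    apply/funext => h; rewrite !mxE.
    have -> : col' i (q + h *: v) = col' i q + h *: col' i v by rewrite raddfD/= linearZ.
    by move: (g _) (g _) => c1 c2; rewrite /GRing.scale/=; ring.
  apply: cvgB => //.
  have : (-1) ^+ b * v 0 i @[h --> (0 : R)^'] --> (-1) ^+ b * v 0 i by exact: cvg_cst.
  apply: cvg_trans; apply: near_eq_cvg; near=> h.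
  rewrite mulVf ?mul1r//; near: h; exact: nbhs_dnbhs_neq.
near=> q.
have bq : ball p r q by near: q; exact: nbhsx_ballx.
split; first exact: rhoA.
  have cx : (-1) ^+ b * (x : 'rV[R]_n) 0 i @[x --> q] --> (-1) ^+ b * q 0 i.
    by apply: (@cvgM R _ (nbhs q)); [exact: cvg_cst|exact: coord_continuous].
  suff cg : g (col' i x) @[x --> q] --> g (col' i q) by rewrite rhoE; exact: (cvgB cx cg).
  have [gq _] := gC1 _ (inb _ bq).
  suff cc : col' i x @[x --> q] --> col' i q by exact: (cvg_comp _ _ cc gq).
  apply/(cvgrPdist_lt (FF := nbhs_filter q)) => e e0; near=> q'.
  have qq' : ball q e q' by near: q'; exact: nbhsx_ballx.
  suff : ball (col' i q) e (col' i q') by rewrite -ball_normE.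
  by case: qq' => _ qq'; split=> // j k; rewrite !mxE; exact: qq'.
move=> v; suff -> : dotv (grad rho q) v =
  (-1) ^+ b * v 0 i - dotv (grad g (col' i q)) (col' i v) by exact: L.
(* Testing [L] on the coordinate directions identifies [grad rho]: coordinate [i] produces the
   linear term, and the coordinates [lift i k] reassemble the gradient of [g]. *)
rewrite /dotv.
under eq_bigr => j _.
  rewrite mxE /partial (derive_val (is_derive := L q (delta_mx 0 j) bq)).
  rewrite mulrBl /dotv big_distrl/=.
  over.
rewrite sumrB; congr (_ - _).
  rewrite (bigD1 i)//= mxE !eqxx/= mulr1 big1 ?addr0// => j ji.
  by rewrite mxE eq_sym (negbTE ji) mulr0 mul0r.
rewrite exchange_big/=; apply: eq_bigr => k _.
rewrite (bigD1 (lift i k))//= !mxE !eqxx/= mulr1 big1 ?addr0// => j jk.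
by rewrite !mxE/= eq_sym (negbTE jk) mulr0 mul0r.
Unshelve. all: by end_near. Qed.

Lemma dotvZl (R : realType) (n : nat) (c : R) (w v : 'rV[R]_n) :
  dotv (c *: w) v = c * dotv w v.
Proof. by rewrite /dotv big_distrr/=; apply: eq_bigr => i _; rewrite mxE mulrA. Qed.

Lemma dotv_continuous (R : realType) (n : nat) (v : 'rV[R]_n) :
  continuous (fun w => dotv w v).
Proof.
apply: continuous_big => [|i _ w]; first exact: add_continuous.
by apply: (@cvgM R _ (nbhs w)); [exact: coord_continuous|exact: cvg_cst].
Qed.

(* Where the directional derivative does not exist, ['D_v N p] is the default value 0. *)
Lemma derive_orthogonal (R : realType) (n : nat) (N : 'rV[R]_n -> 'rV[R]_n)
    (p v : 'rV[R]_n) :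
  (\forall t \near (0 : R), dotv (N (p + t *: v)) v = 0) -> dotv ('D_v N p) v = 0.
Proof.
move=> Nv; rewrite /derive.
set q := fun h : R => _.
have q0 : \forall h \near (0 : R)^', dotv (q h) v = 0.
  apply: nbhs_dnbhs; near=> h.
  have E0 : dotv (N p) v = 0 by rewrite -[p]addr0 -(scale0r v) (nbhs_singleton Nv).
  have Eh : dotv (N (p + h *: v)) v = 0 by near: h.
  rewrite /q /dotv/=.
  under eq_bigr do rewrite !mxE -mulrA mulrBl.
  by rewrite -big_distrr/= sumrB [h *: v + p]addrC -!/(dotv _ _) Eh E0 subrr mulr0.
have [cq|/dvgP ->] := pselect (cvg (q @ 0^')); last first.
  by rewrite /dotv big1// => i _; rewrite mxE mul0r.
have : dotv (q h) v @[h --> (0 : R)^'] --> dotv (lim (q @ 0^')) v.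
  exact: (cvg_comp _ _ cq (@dotv_continuous R n v _)).
move=> cl; apply: (norm_cvg_unique cl).
by apply: cvg_near_cst; exact: q0.
Unshelve. all: by end_near. Qed.

(** If one interior point of the chord were outside [A], the whole open chord would lie in the
    boundary. The defining function then vanishes along it near [p], so the normal stays orthogonal
    to the tangent vector [v], and the second fundamental form vanishes on [v]. *)
Lemma strongly_convex_segment (R : realType) (n : nat) (alpha : R)
    (A : set 'rV[R]_n) (x y : 'rV[R]_n) (s : R) :
  open A -> C2alpha_boundary alpha A -> strongly_convex alpha A -> convex_set A ->
  closure A x -> closure A y -> x != y -> 0 < s < 1 -> A (s *: y + (1 - s) *: x).
Proof.
move=> oA smA scA cA cx cy xy /andP[s0 s1]; apply: contrapT.
set p := _ + _ => Ap; pose v := y - x.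
have vE t : p + t *: v = (s + t) *: y + (1 - (s + t)) *: x.
  by rewrite /p /v; apply/rowP => i; rewrite !mxE; ring.
have v0 : v != 0 by rewrite subr_eq0 eq_sym.
have bp : boundary A p.
  split; last by rewrite ((interior_id A).1 oA).
  have /convex_setP := convex_closure cA; apply => //.
  by rewrite !ltW.
have [rho chart] := smA p bp.
have inc t : - s < t < 1 - s -> closure A (p + t *: v).
  move=> /andP[ts ts1]; rewrite vE; have /convex_setP := convex_closure cA; apply => //.
  by apply/andP; split; lra.
(* A point of the chord in [A] would put [p] in [A], because [p] lies strictly between it and one of
   the endpoints [x], [y] of the closure; the sign of [t] decides which. *)
have notin t : - s < t < 1 - s -> ~ A (p + t *: v).
  move=> /andP[ts ts1] At; apply: Ap.
  have [t0|t0|t0] := ltgtP t 0.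
  - rewrite (_ : p = (- t / (1 - s - t)) *: y + (1 - (- t / (1 - s - t))) *: (p + t *: v)).
      apply: convex_open_closure => //; apply/andP; split.
        by rewrite divr_ge0//; lra.
      by rewrite ltr_pdivrMr; lra.
    rewrite vE /p; apply/rowP => i; rewrite !mxE; field; lra.
  - rewrite (_ : p = (t / (s + t)) *: x + (1 - (t / (s + t))) *: (p + t *: v)).
      apply: convex_open_closure => //; apply/andP; split.
        by rewrite divr_ge0//; lra.
      by rewrite ltr_pdivrMr; lra.
    rewrite vE /p; apply/rowP => i; rewrite !mxE; field; lra.
  - by move: At; rewrite t0 scale0r addr0.
have /nbhs_ballP[r /= r0 rP] := boundary_chart_is_derive chart.
(* Outside [A] the function [rho] is nonpositive; if it were negative at [q], it would be so near
   [q], where there are points of [A]. *)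
have rho0 q : closure A q -> ~ A q -> ball p r q -> rho q = 0.
  move=> cq Aq bq; have [qA rhoc _] := rP q bq.
  apply/eqP; rewrite eq_le leNgt; apply/andP; split; first exact/negP/qA.
  rewrite leNgt; apply/negP => rhoq.
  have [q' [Aq' [rq' bq']]] : A `&` (rho @^-1` [set z | z < 0] `&` ball p r) !=set0.
    apply: cq; apply: filterI; last exact: open_nbhs_nbhs (conj (ball_open p r) bq).
    by apply: rhoc; exact: lt_nbhsl.
  by have [q'A _ _] := rP q' bq'; move/q'A: Aq'; rewrite ltNge => /negP; apply; exact: ltW.
have line : \forall t \near (0 : R), ball p r (p + t *: v) /\ rho (p + t *: v) = 0.
  near=> t.
  have bt : ball p r (p + t *: v).
    near: t; apply: (@continuous_segment R _ p v 0).
    by rewrite scale0r addr0; exact: nbhsx_ballx.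
  have ts : - s < t < 1 - s.
    apply/andP; split; near: t; [apply: lt_nbhsr|apply: lt_nbhsl]; lra.
  by split=> //; apply: rho0 => //; [exact: inc|exact: notin].
(* Each such [t] has a neighbourhood on which [rho] vanishes along the chord, so [t] is trivially a
   minimum. *)
have Dv : \forall t \near (0 : R), dotv (grad rho (p + t *: v)) v = 0.
  apply: filterS (nbhs_interior line) => t nt.
  have [bt rt] := nbhs_singleton nt.
  have [_ _ /(_ v) dt] := rP _ bt.
  apply: (is_derive_min (is_derive_line dt)).
  by apply: filterS nt => t' [_ ->]; rewrite rt.
have Nv : \forall t \near (0 : R), dotv (unit_grad rho (p + t *: v)) v = 0.
  by apply: filterS Dv => t Dt; rewrite dotvZl Dt mulr0.
have := scA p rho bp chart v _ v0.
rewrite /second_fundamental_form (derive_orthogonal Nv) oppr0 ltxx.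
suff -> : dotv v (unit_grad rho p) = 0 by move=> /(_ erefl).
have := nbhs_singleton Nv; rewrite scale0r addr0 => <-.
by apply: eq_bigr => i _; rewrite mulrC.
Unshelve. all: by end_near. Qed.

(** * Behaviour at the boundary *)

Lemma within_near (X Y : topologicalType) (G : set X) (f : X -> Y) (z : X) (U : set Y) :
  {within G, continuous f} -> G z -> nbhs (f z) U -> \forall z' \near z, G z' -> U (f z').
Proof. by move=> cf Gz nU; exact: ((subspace_continuousP _ _).1 cf z Gz U nU). Qed.

Lemma near_within (X Y : topologicalType) (G : set X) (f : X -> Y) :
  (forall z U, G z -> nbhs (f z) U -> \forall z' \near z, G z' -> U (f z')) ->
  {within G, continuous f}.
Proof. by move=> H; apply/subspace_continuousP => z Gz U nU; exact: H. Qed.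

Lemma within_slice (X Y Z : topologicalType) (A : set X) (B : set Y) (f : X * Y -> Z) (y : Y) :
  {within A `*` B, continuous f} -> B y -> {within A, continuous (fun x => f (x, y))}.
Proof.
move=> cf By; apply: near_within => x U Ax nU.
have ny : (fun x' => (x', y)) @ x --> (x, y) by apply: cvg_pair => //; exact: cvg_cst.
have nH : \forall x' \near x, (A `*` B) (x', y) -> U (f (x', y)).
  exact: (ny _ (within_near (z := (x, y)) cf (conj Ax By) nU)).
by apply: filterS nH => x' H Ax'; exact: (H (conj Ax' By)).
Qed.

Lemma within_slice_snd (X Y Z : topologicalType) (A : set X) (B : set Y) (f : X * Y -> Z) (x : X) :
  {within A `*` B, continuous f} -> A x -> {within B, continuous (fun y => f (x, y))}.
Proof.
move=> cf Ax; apply: near_within => y U By nU.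
have ny : (fun y' => (x, y')) @ y --> (x, y) by apply: cvg_pair => //; exact: cvg_cst.
have nH : \forall y' \near y, (A `*` B) (x, y') -> U (f (x, y')).
  exact: (ny _ (within_near (z := (x, y)) cf (conj Ax By) nU)).
by apply: filterS nH => y' H By'; exact: (H (conj Ax By')).
Qed.

(** The derivative is available only in [A], while [z] may be a boundary point: the segment without
    [z] lies in [A], and [f] is continuous up to [z]. *)
Lemma segment_MVT (R : realType) (V : normedModType R) (A : set V) (f : V -> R)
    (D : V -> V -> R) (x z : V) :
  open A -> convex_set A -> {within closure A, continuous f} ->
  (forall y v, A y -> is_derive y v f (D y v)) -> A x -> closure A z ->
  exists2 th, 0 < th < 1 & A (z + th *: (x - z)) /\
    f x - f z = D (z + th *: (x - z)) (x - z).
Proof.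
move=> oA cA cf fD Ax cz.
have inA s : 0 < s <= 1 -> A (z + s *: (x - z)).
  move=> /andP[s0 s1].
  rewrite (_ : z + _ = (1 - s) *: z + (1 - (1 - s)) *: x).
    by apply: convex_open_closure => //; apply/andP; split; lra.
  by rewrite opprB addrCA subrr addr0 scalerBr scalerBl scale1r addrAC addrA.
have cl s : s \in `[0, 1] -> closure A (z + s *: (x - z)).
  rewrite in_itv/= le_eqVlt => /andP[/predU1P[<- _|s0 s1]]; first by rewrite scale0r addr0.
  by apply: subset_closure; apply: inA; rewrite s0.
have [s| |th] := @MVT R (fun s => f (z + s *: (x - z)))
    (fun s => D (z + s *: (x - z)) (x - z)) 0 1 ltr01.
- rewrite in_itv/= => /andP[s0 s1]; apply: is_derive_line; apply: fD.
  by apply: inA; rewrite s0 ltW.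
- apply: near_within => s U s01 nU.
  have nH : \forall s' \near s, closure A (z + s' *: (x - z)) -> U (f (z + s' *: (x - z))).
    exact: (@continuous_segment R _ z (x - z) s _ (within_near cf (cl _ s01) nU)).
  by apply: filterS nH => s' H /cl; exact: H.
rewrite in_itv/= => /andP[th0 th1].
rewrite subr0 mulr1 scale1r scale0r addr0 addrCA subrr addr0 => fE.
by exists th; rewrite ?th0//; split=> //; apply: inA; rewrite th0 ltW.
Qed.

Lemma dotvC (R : realType) (n : nat) (v w : 'rV[R]_n) : dotv v w = dotv w v.
Proof. by apply: eq_bigr => i _; rewrite mulrC. Qed.

Lemma cylinder_MVT (R : realType) (n : nat) (A : set 'rV[R]_n) (T : R)
    (u : 'rV[R]_n -> R -> R) (Du : 'rV[R]_n -> R -> 'rV[R]_n) (x z : 'rV[R]_n) (t : R) :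
  open A -> convex_set A ->
  {within closure A `*` `[0, T], continuous (fun z : 'rV[R]_n * R => u z.1 z.2)} ->
  (forall y v s, A y -> 0 < s < T -> is_derive y v (u ^~ s) (dotv (Du y s) v)) ->
  A x -> closure A z -> 0 < t < T ->
  exists2 th, 0 < th < 1 & A (z + th *: (x - z)) /\
    u x t - u z t = dotv (Du (z + th *: (x - z)) t) (x - z).
Proof.
move=> oA cA cu du Ax cz /[dup] tT /andP[t0 t1].
apply: (@segment_MVT R _ A (u ^~ t) (fun y v => dotv (Du y t) v) x z oA cA _ _ Ax cz).
  apply: (within_slice (y := t) cu).
  by rewrite /= in_itv/= !ltW.
by move=> y v Ay; exact: du.
Qed.

Lemma near_directional (R : realType) (n : nat) (G : set ('rV[R]_n * R))
    (Du : 'rV[R]_n -> R -> 'rV[R]_n) (N p : 'rV[R]_n) (t a b : R) :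
  {within G, continuous (fun z : 'rV[R]_n * R => Du z.1 z.2)} -> G (p, t) ->
  a < dotv (Du p t) N < b ->
  exists2 r, 0 < r & forall y s, ball p r y -> ball t r s -> G (y, s) ->
    a < dotv (Du y s) N < b.
Proof.
move=> cD Gp /andP[aD Db].
have nU : nbhs (Du p t) [set w | a < dotv w N < b].
  have H : nbhs (dotv (Du p t) N) `]a, b[%classic.
    by apply: near_in_itvoo; rewrite in_itv/= aD.
  have H2 : nbhs (Du p t) [set w | `]a, b[%classic (dotv w N)].
    exact: (@dotv_continuous R n N (Du p t) _ H).
  by apply: filterS H2 => w /=; rewrite in_itv.
have /nbhs_ballP[r /= r0 rP] := within_near (z := (p, t)) cD Gp nU.
by exists r => // y s py ts; apply: (rP (y, s)).
Qed.

(** Otherwise strict convexity would put the points [p - e *: N] with small [e > 0] in [A]. There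
    [u] would be negative by the mean value theorem, as it vanishes at [p] and increases along
    [N]. *)
Lemma opposite_inward_notin_closure (R : realType) (n : nat) (A : set 'rV[R]_n) (T : R)
    (u : 'rV[R]_n -> R -> R) (Du : 'rV[R]_n -> R -> 'rV[R]_n) (p N : 'rV[R]_n) (t d : R) :
  open A -> convex_set A ->
  (forall x y s, closure A x -> closure A y -> x != y -> 0 < s < 1 ->
    A (s *: y + (1 - s) *: x)) ->
  {within closure A `*` `[0, T], continuous (fun z : 'rV[R]_n * R => u z.1 z.2)} ->
  {within closure A `*` `[0, T], continuous (fun z : 'rV[R]_n * R => Du z.1 z.2)} ->
  (forall y v s, A y -> 0 < s < T -> is_derive y v (u ^~ s) (dotv (Du y s) v)) ->
  (forall y s, A y -> 0 <= s <= T -> 0 < u y s) ->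
  (forall y s, boundary A y -> 0 <= s <= T -> u y s = 0) ->
  boundary A p -> 0 <= t < T -> 0 < dotv (Du p t) N -> 0 < d ->
  ~ closure A (p - d *: N).
Proof.
move=> oA cA scA cu cD du up ub bp /andP[t0 tT] DN d0 cpN.
have [cp _] := bp.
have N0 : N != 0.
  apply: contraTneq DN => ->; rewrite -leNgt /dotv big1// => i _.
  by rewrite mxE mulr0.
have inA s : 0 < s < d -> A (p - s *: N).
  move=> /andP[s0 sd].
  rewrite (_ : p - _ = (s / d) *: (p - d *: N) + (1 - s / d) *: p).
    apply: scA => //.
      rewrite -subr_eq0 opprB addrCA subrr addr0 scaler_eq0 negb_or N0 andbT.
      by rewrite gt_eqF.
    by rewrite divr_gt0//= ltr_pdivrMr// mul1r.
  by apply/rowP => i; rewrite !mxE; field; rewrite gt_eqF.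
have Gp : (closure A `*` `[0, T]) (p, t).
  by split => //=; rewrite in_itv/= t0 ltW.
have [|r r0 rP] := @near_directional R n _ Du N p t 0 (dotv (Du p t) N + 1) cD Gp.
  by rewrite DN ltrDl ltr01.
(* The time is moved slightly forward because [t] may be 0, whereas derivatives of [u] are given for
   times strictly between 0 and [T]. *)
have [s /andP[s0 sT] ts] : exists2 s, 0 < s < T & ball t r s.
  exists (t + Num.min (r / 2) ((T - t) / 2)).
    have : 0 < Num.min (r / 2) ((T - t) / 2) <= (T - t) / 2.
      by rewrite lt_min ge_min lexx orbT andbT; apply/andP; split; lra.
    by move: (Num.min _ _) => m /andP[m0 m1]; apply/andP; split; lra.
  have : 0 < Num.min (r / 2) ((T - t) / 2) <= r / 2.
    by rewrite lt_min ge_min lexx andbT; apply/andP; split; lra.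
  move: (Num.min _ _) => m /andP[m0 m1].
  by rewrite -ball_normE/= opprD addrA subrr sub0r normrN gtr0_norm//; lra.
pose e := Num.min (d / 2) (r / 2 / `|N|).
have nN0 : 0 < `|N| by rewrite normr_gt0.
have e0 : 0 < e by rewrite lt_min !divr_gt0.
have ed : e < d by rewrite gt_min; apply/orP; left; lra.
have er : e * `|N| < r.
  rewrite -ltr_pdivlMr// gt_min; apply/orP; right.
  by rewrite ltr_pM2r ?invr_gt0//; lra.
have [||th /andP[th0 th1]] :=
  @cylinder_MVT R n A T u Du (p - e *: N) p s oA cA cu du _ cp.
- by apply: inA; rewrite e0.
- by rewrite s0.
have -> : p + th *: (p - e *: N - p) = p - (th * e) *: N.
  by rewrite addrAC subrr sub0r scalerN scalerA.
have -> : p - e *: N - p = - e *: N by rewrite addrAC subrr sub0r scaleNr.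
move=> [Ap]; rewrite (ub p s bp) ?ltW// subr0 => uE.
have : 0 < u (p - e *: N) s.
  by apply: up; [apply: inA; rewrite e0|rewrite !ltW].
have pb : ball p r (p - (th * e) *: N).
  rewrite -ball_normE/= opprB addrCA subrr addr0 normrZ gtr0_norm ?mulr_gt0//.
  by rewrite -mulrA (lt_trans _ er)// gtr_pMl// mulr_gt0.
have /(rP _ _ pb ts) /andP[DN' _] : (closure A `*` `[0, T]) (p - (th * e) *: N, s).
  by split; [exact: subset_closure|rewrite /= in_itv/= !ltW].
rewrite uE; have -> : dotv (Du (p - (th * e) *: N) s) (- e *: N) =
    - e * dotv (Du (p - (th * e) *: N) s) N.
  by rewrite ![dotv (Du _ _) _]dotvC dotvZl.
by rewrite pmulr_lgt0// oppr_gt0 ltNge ltW.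
Qed.

Lemma continuous_convex_comb (R : realType) (V : normedModType R) (s : R) :
  continuous (fun z : (V * V) * R => s *: z.1.2 + (1 - s) *: z.1.1).
Proof.
move=> z; apply: cvgD; apply: cvgZl_tmp.
  exact: (@cvg_comp _ _ _ fst snd _ (nbhs z.1) _ cvg_fst cvg_snd).
exact: (@cvg_comp _ _ _ fst fst _ (nbhs z.1) _ cvg_fst cvg_fst).
Qed.

Lemma concave_lnE (R : realType) (a b s : R) : 0 < a -> 0 < b -> 0 <= s <= 1 ->
  s * ln b + (1 - s) * ln a <= ln (s * b + (1 - s) * a).
Proof. by move=> a0 b0 /andP[s0 s1]; exact: (concave_ln (Itv01 s0 s1) b0 a0). Qed.

Lemma near_directional_chord (R : realType) (n : nat) (G : set ('rV[R]_n * R))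
    (Du : 'rV[R]_n -> R -> 'rV[R]_n) (N p : 'rV[R]_n) (t a b : R) :
  {within G, continuous (fun z : 'rV[R]_n * R => Du z.1 z.2)} -> G (p, t) ->
  a < dotv (Du p t) N < b ->
  exists U W (d : R), [/\ nbhs p U, nbhs t W, 0 < d &
    forall x s sg, U x -> W s -> 0 <= sg <= d -> G (x - sg *: N, s) ->
      a < dotv (Du (x - sg *: N) s) N < b].
Proof.
move=> cD Gp ab; have [r r0 rP] := near_directional cD Gp ab.
have N1 : 0 < `|N| + 1 by rewrite ltr_wpDl.
have r20 : 0 < r / 2 by rewrite divr_gt0.
(* One half of the radius is spent on the distance from [p] to [x], the other on the chord. *)
exists (ball p (r / 2)), (ball t r), (r / 2 / (`|N| + 1)); split.
- exact: nbhsx_ballx.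
- exact: nbhsx_ballx.
- by rewrite divr_gt0.
move=> x s sg px ts /andP[sg0 sgd]; apply: rP => //.
have w2 : `|sg *: N| <= r / 2.
  rewrite normrZ ger0_norm//; move: sgd; rewrite ler_pdivlMr//.
  by apply: le_trans; rewrite ler_wpM2l// lerDl.
move: px; rewrite -!ball_normE/= => px.
have -> : p - (x - sg *: N) = (p - x) + sg *: N by rewrite opprB addrCA addrC.
rewrite (splitr r); apply: (le_lt_trans (ler_normD _ _)).
exact: ltr_leD.
Qed.

(* Along the direction [N], [u] is comparable to the length [s] of the chord from
   [x] to the boundary, and [s] is a concave function of [x]. *)
Lemma Cstar_near_boundary_diagonal (R : realType) (n : nat) (A : set 'rV[R]_n) (T : R)
    (u : 'rV[R]_n -> R -> R) (Du : 'rV[R]_n -> R -> 'rV[R]_n) (p N : 'rV[R]_n)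
    (t lambda eta : R) :
  open A -> convex_set A ->
  (forall x y s, closure A x -> closure A y -> x != y -> 0 < s < 1 ->
    A (s *: y + (1 - s) *: x)) ->
  {within closure A `*` `[0, T], continuous (fun z : 'rV[R]_n * R => u z.1 z.2)} ->
  {within closure A `*` `[0, T], continuous (fun z : 'rV[R]_n * R => Du z.1 z.2)} ->
  (forall y v s, A y -> 0 < s < T -> is_derive y v (u ^~ s) (dotv (Du y s) v)) ->
  (forall y s, A y -> 0 <= s <= T -> 0 < u y s) ->
  (forall y s, boundary A y -> 0 <= s <= T -> u y s = 0) ->
  boundary A p -> 0 <= t < T -> 0 < dotv (Du p t) N -> 0 <= lambda <= 1 -> 0 < eta ->
  \forall z \near (p, p, t), A z.1.1 -> A z.1.2 -> 0 < z.2 < T ->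
    - eta < Cstar (fun x s => ln (u x s)) z.1.1 z.1.2 lambda z.2.
Proof.
move=> oA cA scA cu cD du up ub bp tT DN lI eta0.
have [cp _] := bp.
set c := dotv _ _ in DN.
(* The logarithms of the two bounds differ by [2 * eta / 3], which leaves a margin below [eta]. *)
pose a := c * expR (- (eta / 3)); pose b := c * expR (eta / 3).
have a0 : 0 < a by rewrite mulr_gt0 ?expR_gt0.
have b0 : 0 < b by rewrite mulr_gt0 ?expR_gt0.
have lna : ln a = ln c - eta / 3 by rewrite /a lnM ?posrE ?expR_gt0// expRK.
have lnb : ln b = ln c + eta / 3 by rewrite /b lnM ?posrE ?expR_gt0// expRK.
have Gp : (closure A `*` `[0, T]) (p, t).
  by split => //=; rewrite in_itv/=; case/andP: tT => -> /ltW ->.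
have [|U [W [d [nU0 nW d0 UW]]]] := near_directional_chord (N := N) (a := a) (b := b) cD Gp.
  by rewrite /a /b -/c gtr_pMr// ltr_pMr// expR_gt1 expR_lt1; apply/andP; split; lra.
(* For [x] in [A] and in the smaller neighbourhood, the chord in the direction [- N] must reach the
   boundary at a length at most [d]. *)
have [U' [nU U'U out]] : exists U', [/\ nbhs p U', U' `<=` U &
    forall x, U' x -> ~ closure A (x - d *: N)].
  exists (U `&` [set x | ~ closure A (x - d *: N)]); split=> [||x []//]; last by move=> x [].
  apply: filterI => //.
  have cs : (x : 'rV[R]_n) - d *: N @[x --> p] --> p - d *: N.
    by apply: (@cvgB _ _ _ (nbhs p)); [exact: cvg_id|exact: cvg_cst].
  have out : (~` closure A) (p - d *: N).
    exact: (opposite_inward_notin_closure oA cA scA cu cD du up ub bp tT DN d0).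
  have nO : nbhs (p - d *: N) (~` closure A).
    by apply: open_nbhs_nbhs; split=> //; exact: closed_openC (@closed_closure _ A).
  exact: (cs _ nO).
clearbody a b c.
have value x s sg : A x -> U x -> W s -> 0 < s < T -> 0 < sg <= d ->
    closure A (x - sg *: N) ->
    exists2 D, a < D < b & u x s - u (x - sg *: N) s = sg * D.
  move=> Ax Ux Ws sT /andP[sg0 sgd] cx.
  have [th /andP[th0 th1]] := @cylinder_MVT R n A T u Du x _ s oA cA cu du Ax cx sT.
  have -> : x - (x - sg *: N) = sg *: N by rewrite opprB addrCA subrr addr0.
  have -> : x - sg *: N + th *: (sg *: N) = x - ((1 - th) * sg) *: N.
    by apply/rowP => i; rewrite !mxE; ring.
  set y := x - _; move=> [Ay ->].
  exists (dotv (Du y s) N); last by rewrite dotvC dotvZl dotvC.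
  have th10 : 0 <= 1 - th by rewrite subr_ge0 ltW.
  have sI : 0 <= (1 - th) * sg <= d.
    rewrite mulr_ge0 ?(ltW sg0)//=; apply: le_trans sgd.
    by rewrite ger_pMl// gerBl ltW.
  have Gy : (closure A `*` `[0, T]) (y, s).
    by case/andP: sT => s0 s1; split; [exact: subset_closure|rewrite /= in_itv/= !ltW].
  exact: (UW _ _ _ Ux Ws sI Gy).
have upper x s : A x -> U' x -> W s -> 0 < s < T ->
    exists sg, [/\ 0 < sg <= d, closure A (x - sg *: N) & ln (u x s) <= ln sg + ln b].
  move=> Ax U'x Ws sT.
  have sT' : 0 <= s <= T by case/andP: sT => s0 s1; rewrite !ltW.
  have [|th [/andP[th0 th1] + _]] := @segment_exit R n A x (x - d *: N) oA Ax.
    by move=> /subset_closure; exact: out.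
  have -> : x + th *: (x - d *: N - x) = x - (th * d) *: N.
    by apply/rowP => i; rewrite !mxE; ring.
  move=> bz; have sgd : 0 < th * d <= d by rewrite mulr_gt0//= ler_piMl// ltW.
  have [cz _] := bz.
  exists (th * d); split=> //.
  have [D /andP[Da Db]] := value x s (th * d) Ax (U'U _ U'x) Ws sT sgd cz.
  case/andP: sgd => sg0 _.
  rewrite (ub _ _ bz sT') subr0 => ->.
  have D0 : 0 < D by exact: lt_trans Da.
  rewrite -lnM ?posrE// ler_ln ?posrE; first by rewrite ler_pM2l// ltW.
    exact: mulr_gt0.
  exact: mulr_gt0.
(* The endpoint of the chord need only be in the closure, where [u >= 0]; it need not be the exit
   point. *)
have lower x s sg : A x -> U x -> W s -> 0 < s < T -> 0 < sg <= d ->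
    closure A (x - sg *: N) -> ln sg + ln a <= ln (u x s).
  move=> Ax Ux Ws sT /[dup] sgd /andP[sg0 _] cx.
  have sT' : 0 <= s <= T by case/andP: sT => s0 s1; rewrite !ltW.
  have [D /andP[Da Db] uE] := value x s sg Ax Ux Ws sT sgd cx.
  rewrite -lnM ?posrE// ler_ln ?posrE; [|exact: mulr_gt0|exact: up].
  have uz : 0 <= u (x - sg *: N) s.
    have [Az|Az] := pselect (A (x - sg *: N)); first exact/ltW/up.
    by rewrite ub//; split=> //; rewrite ((interior_id A).1 oA).
  have : sg * a <= sg * D by rewrite ler_pM2l// ltW.
  by move: uE; lra.
have n2 : nbhs (lambda *: (p, p, t).1.2 + (1 - lambda) *: (p, p, t).1.1) U.
  by rewrite /= -scalerDl addrCA subrr addr0 scale1r.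
near=> z => Az1 Az3 zT.
have U1 : U' z.1.1 by near: z; exact: (cvg_comp _ _ cvg_fst cvg_fst _ nU).
have U3 : U' z.1.2 by near: z; exact: (cvg_comp _ _ cvg_fst cvg_snd _ nU).
have U2 : U (lambda *: z.1.2 + (1 - lambda) *: z.1.1).
  by near: z; exact: (@continuous_convex_comb _ _ lambda (p, p, t) _ n2).
have Wz : W z.2 by near: z; exact: (@cvg_snd _ _ (nbhs (p, p)) (nbhs t) _ _ nW).
have [s1 [s1I cs1 u1]] := upper _ _ Az1 U1 Wz zT.
have [s3 [s3I cs3 u3]] := upper _ _ Az3 U3 Wz zT.
have Az2 : A (lambda *: z.1.2 + (1 - lambda) *: z.1.1) by exact: ((convex_setP A).1 cA).
(* Concavity of the chord length appears here: the point at distance [s2] along the chord from the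
   intermediate point is a convex combination of the two exit points, hence in the closure. *)
pose s2 := lambda * s3 + (1 - lambda) * s1.
case/andP: (s1I) => s10 s1d; case/andP: (s3I) => s30 s3d; case/andP: (lI) => l0 l1.
have s2I : 0 < s2 <= d.
  rewrite /s2; have := ler_wpM2l l0 s3d; have := @ler_wpM2l _ (1 - lambda) _ _ _ s1d.
  rewrite subr_ge0 => /(_ l1) h1 h3; apply/andP; split; last by lra.
  have [->|l00] := eqVneq lambda 0; first by rewrite mul0r add0r subr0 mul1r.
  have {}l00 : 0 < lambda by rewrite lt_neqAle eq_sym l00.
  by rewrite ltr_pwDl ?mulr_gt0 ?mulr_ge0 ?subr_ge0// ltW.
have cs2 : closure A (lambda *: z.1.2 + (1 - lambda) *: z.1.1 - s2 *: N).
  have -> : lambda *: z.1.2 + (1 - lambda) *: z.1.1 - s2 *: N =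
      lambda *: (z.1.2 - s3 *: N) + (1 - lambda) *: (z.1.1 - s1 *: N).
    by rewrite /s2; apply/rowP => i; rewrite !mxE; ring.
  by have /convex_setP := convex_closure cA; apply.
have := lower _ _ _ Az2 U2 Wz zT s2I cs2.
have := concave_lnE s10 s30 lI.
rewrite -/s2 /Cstar.
have := ler_wpM2l l0 u3; have := @ler_wpM2l _ (1 - lambda) _ _ _ u1.
by rewrite subr_ge0 => /(_ l1); rewrite lna lnb; lra.
Unshelve. all: by end_near. Qed.

Lemma near_pair_snd (X Y Z : topologicalType) (f : X * Y -> Z) (z : X * Y) (P : Z * Y -> Prop) :
  {for z, continuous f} -> (\forall w \near (f z, z.2), P w) ->
  \forall z' \near z, P (f z', z'.2).
Proof.
move=> cf nP.
have c : (f z', z'.2) @[z' --> z] --> (f z, z.2) by apply: cvg_pair => //; exact: cvg_snd.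
exact: (c _ nP).
Qed.

Lemma ln_near_lt (R : realType) (X : topologicalType) (G : set X) (f : X -> R) (z : X) (B : R) :
  {within G, continuous f} -> G z -> f z < expR B ->
  \forall z' \near z, G z' -> 0 < f z' -> ln (f z') < B.
Proof.
move=> cf Gz fB; apply: filterS (within_near cf Gz (lt_nbhsl fB)) => z' H Gz' f0.
by rewrite -(expRK B) ltr_ln ?posrE ?expR_gt0//; exact: H.
Qed.

Lemma ln_near_gt (R : realType) (X : topologicalType) (G : set X) (f : X -> R) (z : X) (B : R) :
  {within G, continuous f} -> G z -> expR B < f z ->
  \forall z' \near z, G z' -> B < ln (f z').
Proof.
move=> cf Gz fB; apply: filterS (within_near cf Gz (lt_nbhsr fB)) => z' H Gz'.
rewrite -(expRK B) ltr_ln ?posrE ?expR_gt0//; first exact: H.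
exact: lt_trans (expR_gt0 _) (H Gz').
Qed.

(** Bounds on logarithms are expressed through [expR], so that they make sense where [u] vanishes;
    at such an endpoint [B1] or [B3] may be arbitrarily negative. *)
Lemma Cstar_ln_near (R : realType) (n : nat) (A : set 'rV[R]_n) (T : R)
    (u : 'rV[R]_n -> R -> R) (x1 x3 : 'rV[R]_n) (t lambda B1 B2 B3 : R) :
  open A -> convex_set A ->
  {within closure A `*` `[0, T], continuous (fun z : 'rV[R]_n * R => u z.1 z.2)} ->
  (forall y s, A y -> 0 <= s <= T -> 0 < u y s) ->
  closure A x1 -> closure A x3 -> 0 <= t <= T -> 0 <= lambda <= 1 ->
  u x1 t < expR B1 -> u x3 t < expR B3 ->
  expR B2 < u (lambda *: x3 + (1 - lambda) *: x1) t ->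
  \forall z \near (x1, x3, t), A z.1.1 -> A z.1.2 -> 0 <= z.2 <= T ->
    B2 - lambda * B3 - (1 - lambda) * B1 < Cstar (fun x s => ln (u x s)) z.1.1 z.1.2 lambda z.2.
Proof.
move=> oA cA cu up cx1 cx3 tT /[dup] lI /andP[l0 l1] u1 u3 u2.
have G1 : (closure A `*` `[0, T]) (x1, t) by split; rewrite //= in_itv.
have G3 : (closure A `*` `[0, T]) (x3, t) by split; rewrite //= in_itv.
have G2 : (closure A `*` `[0, T]) (lambda *: x3 + (1 - lambda) *: x1, t).
  by split; rewrite /= ?in_itv//; have /convex_setP := convex_closure cA; exact.
have n1 : \forall z \near (x1, x3, t), (closure A `*` `[0, T]) (z.1.1, z.2) ->
    0 < u z.1.1 z.2 -> ln (u z.1.1 z.2) < B1.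
  exact: (@near_pair_snd _ _ _ (fun z : ('rV[R]_n * 'rV[R]_n) * R => z.1.1) (x1, x3, t) _
    (cvg_comp _ _ cvg_fst cvg_fst) (ln_near_lt (z := (x1, t)) cu G1 u1)).
have n3 : \forall z \near (x1, x3, t), (closure A `*` `[0, T]) (z.1.2, z.2) ->
    0 < u z.1.2 z.2 -> ln (u z.1.2 z.2) < B3.
  exact: (@near_pair_snd _ _ _ (fun z : ('rV[R]_n * 'rV[R]_n) * R => z.1.2) (x1, x3, t) _
    (cvg_comp _ _ cvg_fst cvg_snd) (ln_near_lt (z := (x3, t)) cu G3 u3)).
have n2 : \forall z \near (x1, x3, t),
    (closure A `*` `[0, T]) (lambda *: z.1.2 + (1 - lambda) *: z.1.1, z.2) ->
    B2 < ln (u (lambda *: z.1.2 + (1 - lambda) *: z.1.1) z.2).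
  exact: (@near_pair_snd _ _ _ _ (x1, x3, t) _
    (@continuous_convex_comb _ _ lambda (x1, x3, t)) (ln_near_gt (z := (_, t)) cu G2 u2)).
near=> z => Az1 Az3 zT.
have Az2 : A (lambda *: z.1.2 + (1 - lambda) *: z.1.1) by exact: ((convex_setP A).1 cA).
have inG y : A y -> (closure A `*` `[0, T]) (y, z.2).
  by move=> Ay; split; [exact: subset_closure|rewrite /= in_itv].
have H1 : ln (u z.1.1 z.2) < B1.
  by apply: (near n1 z) => //; [exact: inG|exact: up].
have H3 : ln (u z.1.2 z.2) < B3.
  by apply: (near n3 z) => //; [exact: inG|exact: up].
have H2 : B2 < ln (u (lambda *: z.1.2 + (1 - lambda) *: z.1.1) z.2).
  by apply: (near n2 z) => //; exact: inG.
rewrite /Cstar; have := ler_wpM2l l0 (ltW H3).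
have := @ler_wpM2l _ (1 - lambda) _ _ _ (ltW H1).
by rewrite subr_ge0 => /(_ l1); lra.
Unshelve. all: by end_near. Qed.

(** At least one endpoint has [u = 0] and a positive weight, while [u] is positive at the
    intermediate point; hence the concavity function tends to infinity. *)
Lemma Cstar_near_boundary (R : realType) (n : nat) (A : set 'rV[R]_n) (T : R)
    (u : 'rV[R]_n -> R -> R) (x1 x3 : 'rV[R]_n) (t lambda K : R) :
  open A -> convex_set A ->
  {within closure A `*` `[0, T], continuous (fun z : 'rV[R]_n * R => u z.1 z.2)} ->
  (forall y s, A y -> 0 <= s <= T -> 0 < u y s) ->
  (forall y s, boundary A y -> 0 <= s <= T -> u y s = 0) ->
  closure A x1 -> closure A x3 -> 0 <= t <= T -> 0 < lambda < 1 ->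
  A (lambda *: x3 + (1 - lambda) *: x1) -> ~ (A x1 /\ A x3) ->
  \forall z \near (x1, x3, t), A z.1.1 -> A z.1.2 -> 0 <= z.2 <= T ->
    K < Cstar (fun x s => ln (u x s)) z.1.1 z.1.2 lambda z.2.
Proof.
move=> oA cA cu up ub cx1 cx3 tT /andP[l0 l1] A2 A13.
set x2 := _ + _ in A2.
have u2 : 0 < u x2 t by exact: up.
have lI : 0 <= lambda <= 1 by rewrite !ltW.
have u0 x : closure A x -> ~ A x -> u x t = 0.
  by move=> cx Ax; apply: ub => //; split=> //; rewrite ((interior_id A).1 oA).
have uge x : closure A x -> 0 <= u x t.
  by move=> cx; have [Ax|/(u0 _ cx)->//] := pselect (A x); rewrite ltW ?up.
pose B2 := ln (u x2 t) - 1.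
have HB2 : expR B2 < u x2 t.
  by rewrite expRB lnK ?posrE// ltr_pdivrMr ?expR_gt0// ltr_pMr// expR_gt1.
pose B x := ln (u x t + 1).
have HB x : closure A x -> u x t < expR (B x).
  by move=> cx; rewrite /B lnK ?ltrDl// posrE ltr_wpDl// uge.
have [A1|A1] := pselect (A x1).
  have A3 : ~ A x3 by move=> A3; apply: A13.
  (* The exponent solves [B2 - lambda * B3 - (1 - lambda) * B1 = K] for [B3]; the other case solves
     for [B1]. *)
  have H3 : u x3 t < expR ((B2 - (1 - lambda) * B x1 - K) / lambda).
    by rewrite u0// expR_gt0.
  have := Cstar_ln_near oA cA cu up cx1 cx3 tT lI (HB _ cx1) H3 HB2.
  apply: filterS => z H Az1 Az3 zT; move: (H Az1 Az3 zT).
  by rewrite mulrC divfK ?gt_eqF//; lra.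
have l10 : 1 - lambda != 0 by rewrite subr_eq0 gt_eqF.
have H1 : u x1 t < expR ((B2 - lambda * B x3 - K) / (1 - lambda)).
  by rewrite u0// expR_gt0.
have := Cstar_ln_near oA cA cu up cx1 cx3 tT lI H1 (HB _ cx3) HB2.
apply: filterS => z H Az1 Az3 zT; move: (H Az1 Az3 zT).
by rewrite [(1 - lambda) * _]mulrC divfK//; lra.
Qed.

Lemma Cstar_lsc (R : realType) (n : nat) (A : set 'rV[R]_n) (T : R)
    (u : 'rV[R]_n -> R -> R) (x1 x3 : 'rV[R]_n) (t lambda e : R) :
  open A -> convex_set A ->
  {within closure A `*` `[0, T], continuous (fun z : 'rV[R]_n * R => u z.1 z.2)} ->
  (forall y s, A y -> 0 <= s <= T -> 0 < u y s) ->
  A x1 -> A x3 -> 0 <= t <= T -> 0 <= lambda <= 1 -> 0 < e ->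
  \forall z \near (x1, x3, t), A z.1.1 -> A z.1.2 -> 0 <= z.2 <= T ->
    Cstar (fun x s => ln (u x s)) x1 x3 lambda t - e <
    Cstar (fun x s => ln (u x s)) z.1.1 z.1.2 lambda z.2.
Proof.
move=> oA cA cu up A1 A3 tT lI e0.
have A2 : A (lambda *: x3 + (1 - lambda) *: x1) by exact: ((convex_setP A).1 cA).
(* Each logarithm is allowed an error [e / 2]; the weights [lambda] and [1 - lambda] add up to 1, so
   the total error is [e]. *)
have H x : A x -> u x t < expR (ln (u x t) + e / 2).
  by move=> /up /(_ tT) ux; rewrite expRD lnK ?posrE// ltr_pMr// expR_gt1; lra.
have H2 x : A x -> expR (ln (u x t) - e / 2) < u x t.
  move=> /up /(_ tT) ux; rewrite expRB lnK ?posrE// ltr_pdivrMr ?expR_gt0//.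
  by rewrite ltr_pMr// expR_gt1; lra.
have := Cstar_ln_near oA cA cu up (subset_closure A1) (subset_closure A3) tT lI
  (H _ A1) (H _ A3) (H2 _ A2).
apply: filterS => z Hz Az1 Az3 zT; apply: le_lt_trans (Hz Az1 Az3 zT).
by rewrite /Cstar; lra.
Qed.

(** * The minimum principle *)

Lemma is_derive_ln_comp (R : realType) (f : R -> R) (s d : R) :
  is_derive s 1 f d -> 0 < f s -> is_derive s 1 (fun h => ln (f h)) (d / f s).
Proof.
move=> fd f0; rewrite mulrC.
have lnd := is_derive1_ln f0.
exact: is_derive1_comp.
Qed.

Lemma is_derive_div (R : realType) (f g : R -> R) (s df dg : R) :
  is_derive s 1 f df -> is_derive s 1 g dg -> g s != 0 ->
  is_derive s 1 (fun h => f h / g h) (df / g s - f s * dg / g s ^+ 2).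
Proof.
move=> fd gd g0.
have gV := is_deriveV g0 gd.
apply: (is_derive_eq (is_deriveM fd gV)).
by rewrite /GRing.scale/=; field.
Qed.

Lemma near_line (R : realType) (V : normedModType R) (A : set V) (x v : V) :
  open A -> A x -> \forall h \near (0 : R), A (x + h *: v).
Proof.
move=> oA Ax; apply: (@continuous_segment R _ x v 0).
by rewrite scale0r addr0; exact: open_nbhs_nbhs.
Qed.

Lemma dotv_delta (R : realType) (n : nat) (w : 'rV[R]_n) (i : 'I_n) :
  dotv w (delta_mx 0 i) = w 0 i.
Proof.
rewrite /dotv (bigD1 i)//= mxE !eqxx/= mulr1 big1 ?addr0// => j ji.
by rewrite mxE (negbTE ji) mulr0.
Qed.

(* At a minimum the logarithmic gradients at the three points agree, so the
   squared gradients cancel in the second-order condition along equal shifts. *)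
Lemma Cstar_min_laplacian (R : realType) (n : nat) (A : set 'rV[R]_n)
    (w : 'rV[R]_n -> R) (x1 x3 : 'rV[R]_n) (lambda : R) :
  let x2 := lambda *: x3 + (1 - lambda) *: x1 in
  let C y1 y3 := ln (w (lambda *: y3 + (1 - lambda) *: y1)) - lambda * ln (w y3) -
    (1 - lambda) * ln (w y1) in
  open A -> convex_set A -> C2_on A w -> (forall x, A x -> 0 < w x) ->
  A x1 -> A x3 -> 0 < lambda < 1 ->
  (forall y1 y3, A y1 -> A y3 -> C x1 x3 <= C y1 y3) ->
  0 <= laplacian w x2 / w x2 - lambda * (laplacian w x3 / w x3) -
    (1 - lambda) * (laplacian w x1 / w x1).
Proof.
move=> x2 C oA cA [w1 w2] w0 A1 A3 /andP[l0 l1] Cmin.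
have A2 : A x2 by apply: ((convex_setP A).1 cA) => //; rewrite !ltW.
have lnd x v h : A (x + h *: v) ->
    is_derive h 1 (fun h => ln (w (x + h *: v))) (dotv (grad w (x + h *: v)) v / w (x + h *: v)).
  move=> Ax; apply: (@is_derive_ln_comp _ (fun h => w (x + h *: v))); last exact: w0.
  exact/is_derive_line/(C1_on_is_derive v oA w1 Ax).
have lnd0 x v : A x -> is_derive (0 : R) 1 (fun h => ln (w (x + h *: v))) (dotv (grad w x) v / w x).
  by move=> Ax; have := lnd x v 0; rewrite scale0r addr0; exact.
pose q i x := partial i w x / w x.
(* Moving [x1] alone by [h *: e] moves the intermediate point by [1 - lambda] times that shift, so
   the first-order condition compares the two logarithmic gradients. Moving [x3] gives the other
   equality. *)
have q21 i : q i x2 = q i x1.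
  pose e : 'rV[R]_n := delta_mx 0 i.
  have dC : is_derive (0 : R) 1 (fun h => C (x1 + h *: e) x3) ((1 - lambda) * (q i x2 - q i x1)).
    have -> : (fun h => C (x1 + h *: e) x3) = (fun h => ln (w (x2 + h *: ((1 - lambda) *: e)))) -
        cst (lambda * ln (w x3)) - (1 - lambda) \*: (fun h => ln (w (x1 + h *: e))).
      apply/funext => h; rewrite /C; congr (ln (w _) - _ - _).
      by rewrite scalerDr addrA !scalerA [h * _]mulrC.
    apply: is_derive_eq; first exact: (is_deriveB (is_deriveB (lnd0 _ _ A2) (is_derive_cst _ _ _))
      (is_deriveZ _ (lnd0 _ _ A1))).
    rewrite dotvC dotvZl dotvC !dotv_delta !mxE subr0 /GRing.scale/= /q; ring.
  have : (1 - lambda) * (q i x2 - q i x1) = 0.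
    apply: (is_derive_min dC); apply: filterS (near_line e oA A1) => h Ah.
    by rewrite scale0r addr0; exact: Cmin.
  by move=> /eqP; rewrite mulf_eq0 subr_eq0 gt_eqF//= subr_eq0 => /eqP.
have q23 i : q i x2 = q i x3.
  pose e : 'rV[R]_n := delta_mx 0 i.
  have dC : is_derive (0 : R) 1 (fun h => C x1 (x3 + h *: e)) (lambda * (q i x2 - q i x3)).
    have -> : (fun h => C x1 (x3 + h *: e)) = (fun h => ln (w (x2 + h *: (lambda *: e)))) -
        lambda \*: (fun h => ln (w (x3 + h *: e))) - cst ((1 - lambda) * ln (w x1)).
      apply/funext => h; rewrite /C; congr (ln (w _) - _ - _).
      by rewrite scalerDr addrAC !scalerA [h * _]mulrC.
    apply: is_derive_eq; first exact: (is_deriveB (is_deriveB (lnd0 _ _ A2)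
      (is_deriveZ _ (lnd0 _ _ A3))) (is_derive_cst _ _ _)).
    rewrite dotvC dotvZl dotvC !dotv_delta !mxE subr0 /GRing.scale/= /q; ring.
  have : lambda * (q i x2 - q i x3) = 0.
    apply: (is_derive_min dC); apply: filterS (near_line e oA A3) => h Ah.
    by rewrite scale0r addr0; exact: Cmin.
  by move=> /eqP; rewrite mulf_eq0 gt_eqF//= subr_eq0 => /eqP.
have second i : 0 <= partial i (partial i w) x2 / w x2 -
    lambda * (partial i (partial i w) x3 / w x3) -
    (1 - lambda) * (partial i (partial i w) x1 / w x1).
  pose e : 'rV[R]_n := delta_mx 0 i.
  pose P x := partial i (partial i w) x / w x.
  have d1 x h : A (x + h *: e) -> is_derive h 1 (fun h => ln (w (x + h *: e))) (q i (x + h *: e)).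
    by move=> /lnd; rewrite dotv_delta mxE.
  have d2 x : A x -> is_derive (0 : R) 1 (fun h => q i (x + h *: e)) (P x - q i x ^+ 2).
    move=> Ax.
    have dw : is_derive (0 : R) 1 (fun h => w (x + h *: e)) (partial i w x).
      apply: is_derive_line; rewrite scale0r addr0.
      by apply: derivableP; have [_ /(_ i)[]] := w1 x Ax.
    have dpw : is_derive (0 : R) 1 (fun h => partial i w (x + h *: e)) (partial i (partial i w) x).
      apply: is_derive_line; rewrite scale0r addr0.
      by apply: derivableP; have [_ /(_ i)[]] := w2 i x Ax.
    have wx : w x != 0 by rewrite gt_eqF// w0.
    have := @is_derive_div _ (fun h => partial i w (x + h *: e))
      (fun h => w (x + h *: e)) 0 _ _ dpw dw.
    rewrite scale0r addr0 => /(_ wx) /is_derive_eq; apply.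
    by rewrite /P /q; field.
  (* Equal shifts of both endpoints shift the intermediate point by the same vector. *)
  have CE : (fun h => C (x1 + h *: e) (x3 + h *: e)) = (fun h => ln (w (x2 + h *: e))) -
      lambda \*: (fun h => ln (w (x3 + h *: e))) - (1 - lambda) \*: (fun h => ln (w (x1 + h *: e))).
    apply/funext => h; rewrite /C; congr (ln (w _) - _ - _).
    by rewrite /x2; apply/rowP => j; rewrite !mxE; ring.
  pose Q := (fun h => q i (x2 + h *: e)) - lambda \*: (fun h => q i (x3 + h *: e)) -
    (1 - lambda) \*: (fun h => q i (x1 + h *: e)).
  have dC : \forall h \near (0 : R),
      is_derive (h : R) 1 (fun h => C (x1 + h *: e) (x3 + h *: e)) (Q h).
    near=> h; rewrite CE; apply: is_deriveB; first apply: is_deriveB.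
    - by apply: d1; near: h; exact: near_line.
    - by apply: is_deriveZ; apply: d1; near: h; exact: near_line.
    - by apply: is_deriveZ; apply: d1; near: h; exact: near_line.
  have dQ : is_derive (0 : R) 1 Q ((P x2 - q i x2 ^+ 2) - lambda *: (P x3 - q i x3 ^+ 2) -
      (1 - lambda) *: (P x1 - q i x1 ^+ 2)).
    by apply: is_deriveB; [apply: is_deriveB; [exact: d2|exact/is_deriveZ/d2]|exact/is_deriveZ/d2].
  have Cm : \forall h \near (0 : R), C (x1 + 0 *: e) (x3 + 0 *: e) <= C (x1 + h *: e) (x3 + h *: e).
    near=> h; rewrite !scale0r !addr0; apply: Cmin; near: h; exact: near_line.
  have := second_derive_min dC dQ Cm.
  rewrite /GRing.scale/= => H.
  (* The common square of [q] enters with total weight [1 - lambda - (1 - lambda) = 0]. *)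
  have E1 := q21 i; have E3 := q23 i.
  rewrite -E3 -E1 in H.
  rewrite -[0 <= _]/(0 <= P x2 - lambda * P x3 - (1 - lambda) * P x1).
  move: (P x1) (P x2) (P x3) (q i x2) H => p1 p2 p3 qq; clear; lra.
have -> : laplacian w x2 / w x2 - lambda * (laplacian w x3 / w x3) -
    (1 - lambda) * (laplacian w x1 / w x1) =
  \sum_i (partial i (partial i w) x2 / w x2 - lambda * (partial i (partial i w) x3 / w x3) -
    (1 - lambda) * (partial i (partial i w) x1 / w x1)).
  by rewrite !sumrB -!big_distrr/= -!big_distrl.
by apply: sumr_ge0 => i _; exact: second.
Unshelve. all: by end_near. Qed.

(* The time derivative of the concavity function at an interior minimum is
   nonpositive, while the equation bounds it from below. *)
Lemma parabolic_min_contradiction (R : realType) (n : nat) (A : set 'rV[R]_n) (T k S : R)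
    (a : 'rV[R]_n -> R -> R) (u ut : 'rV[R]_n -> R -> R) (x1 x3 : 'rV[R]_n) (t lambda : R) :
  open A -> convex_set A -> 0 < t < T -> C2_on A (u ^~ t) ->
  (forall x, A x -> is_derive t 1 (u x) (ut x t)) ->
  (forall x, A x -> 0 < u x t) ->
  (forall x, A x -> ut x t - laplacian (u ^~ t) x = a x t * u x t) ->
  A x1 -> A x3 -> 0 < lambda < 1 -> - S <= Cstar a x1 x3 lambda t -> S < k ->
  (forall y1 y3 s, A y1 -> A y3 -> 0 <= s <= t ->
    Cstar (fun x s => ln (u x s)) x1 x3 lambda t + k * t <=
    Cstar (fun x s => ln (u x s)) y1 y3 lambda s + k * s) -> False.
Proof.
(* Adding the inequalities gives [k <= S], against [S < k]. *)
have combine (L1 L2 L3 a1 a2 a3 : R) : 0 <= L2 - lambda * L3 - (1 - lambda) * L1 ->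
    - S <= a2 - lambda * a3 - (1 - lambda) * a1 -> S < k ->
    L2 + a2 - lambda * (L3 + a3) - (1 - lambda) * (L1 + a1) + k <= 0 -> False by lra.
move=> oA cA /andP[t0 tT] u2 du u0 ueq A1 A3 lI aS Sk umin.
set x2 := lambda *: x3 + (1 - lambda) *: x1.
have A2 : A x2.
  by case/andP: lI => l0 l1; apply: ((convex_setP A).1 cA) => //; rewrite !ltW.
have lap := @Cstar_min_laplacian R n A (u ^~ t) x1 x3 lambda oA cA u2 u0 A1 A3 lI.
have {}lap : 0 <= laplacian (u ^~ t) x2 / u x2 t - lambda * (laplacian (u ^~ t) x3 / u x3 t) -
    (1 - lambda) * (laplacian (u ^~ t) x1 / u x1 t).
  apply: lap => y1 y3 Ay1 Ay3; have := umin y1 y3 t Ay1 Ay3.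
  by rewrite lexx andbT (ltW t0) lerD2r => /(_ isT).
have dln x : A x -> is_derive t 1 (fun s => ln (u x s)) (ut x t / u x t).
  by move=> Ax; apply: is_derive_ln_comp; [exact: du|exact: u0].
pose f := (fun s => ln (u x2 s)) - lambda \*: (fun s => ln (u x3 s)) -
  (1 - lambda) \*: (fun s => ln (u x1 s)) + (fun s => k * s).
have df : is_derive t 1 f (ut x2 t / u x2 t - lambda *: (ut x3 t / u x3 t) -
    (1 - lambda) *: (ut x1 t / u x1 t) + k).
  apply: is_deriveD; first apply: is_deriveB; first apply: is_deriveB.
  - exact: dln.
  - exact/is_deriveZ/dln.
  - exact/is_deriveZ/dln.
  - apply: (is_derive_eq (is_deriveM (is_derive_cst k t (1 : R)) (is_derive_id t (1 : R)))).
    by rewrite /GRing.scale/= mulr0 addr0 mulr1.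
have := is_derive_left_min df.
have fm : \forall s \near t, s < t -> f t <= f s.
  near=> s => st; apply: umin => //; rewrite (ltW st) andbT.
  by apply: ltW; near: s; exact: lt_nbhsr.
move=> /(_ fm).
(* Dividing the equation by [u] gives the time derivative of the logarithm directly in terms of the
   quotients treated by [Cstar_min_laplacian]. *)
have E x : A x -> ut x t / u x t = laplacian (u ^~ t) x / u x t + a x t.
  move=> Ax; have /eqP := ueq x Ax; rewrite subr_eq => /eqP ->.
  by rewrite mulrDl mulfK ?gt_eqF ?u0// addrC.
by rewrite (E _ A1) (E _ A2) (E _ A3); exact: combine lap aS Sk.
Unshelve. all: by end_near. Qed.

(** Minimising over [[0, t]] with [t < T] keeps the minimum at a time where [u] is differentiable,
    even if it occurs at the last time [t]. The slope [k > S] makes the contradiction strict. *)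
Lemma Cstar_ln_ge (R : realType) (n : nat) (A : set 'rV[R]_n) (T S : R)
    (a u ut : 'rV[R]_n -> R -> R) (Du : 'rV[R]_n -> R -> 'rV[R]_n)
    (nu : 'rV[R]_n -> 'rV[R]_n) (x1 x3 : 'rV[R]_n) (t lambda : R) :
  open A -> convex_set A -> compact (closure A) ->
  (forall x y s, closure A x -> closure A y -> x != y -> 0 < s < 1 ->
    A (s *: y + (1 - s) *: x)) ->
  {within closure A `*` `[0, T], continuous (fun z : 'rV[R]_n * R => u z.1 z.2)} ->
  {within closure A `*` `[0, T], continuous (fun z : 'rV[R]_n * R => Du z.1 z.2)} ->
  (forall y v s, A y -> 0 < s < T -> is_derive y v (u ^~ s) (dotv (Du y s) v)) ->
  (forall y s, A y -> 0 < s < T -> is_derive s 1 (u y) (ut y s)) ->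
  (forall s, 0 < s < T -> C2_on A (u ^~ s)) ->
  (forall y s, A y -> 0 < s < T -> ut y s - laplacian (u ^~ s) y = a y s * u y s) ->
  (forall y s, A y -> 0 <= s <= T -> 0 < u y s) ->
  (forall y s, boundary A y -> 0 <= s <= T -> u y s = 0) ->
  (forall y s, boundary A y -> 0 <= s <= T -> 0 < dotv (Du y s) (nu y)) ->
  0 < lambda < 1 ->
  (forall y1 y3, A y1 -> A y3 -> 0 <= Cstar (fun x s => ln (u x s)) y1 y3 lambda 0) ->
  (forall y1 y3 s, A y1 -> A y3 -> 0 < s < T -> - S <= Cstar a y1 y3 lambda s) ->
  0 <= S -> A x1 -> A x3 -> 0 <= t < T ->
  - (S * t) <= Cstar (fun x s => ln (u x s)) x1 x3 lambda t.
Proof.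
move=> oA cA cptA scA cu cD du dut u2 ueq up ub Dub lI init aS S0 A1 A3 /andP[t0 tT].
pose C := Cstar (fun x s => ln (u x s)).
have [->|tn0] := eqVneq t 0; first by rewrite mulr0 oppr0; exact: init.
have {tn0} tp : 0 < t by rewrite lt_neqAle eq_sym tn0.
have lI' : 0 <= lambda <= 1 by case/andP: lI => l0 l1; rewrite !ltW.
suff pos k : S < k -> 0 <= C x1 x3 lambda t + k * t.
  rewrite leNgt; apply/negP => neg.
  (* Here [g] is the supposed deficit; the slope [S + g / (2 * t)] recovers only half of it and
     leaves [- (g / 2)]. *)
  pose g := - (S * t) - C x1 x3 lambda t.
  have g0 : 0 < g by rewrite subr_gt0.
  have := pos (S + g / (2 * t)); rewrite ltrDl divr_gt0 ?mulr_gt0// => /(_ isT).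
  have -> : C x1 x3 lambda t + (S + g / (2 * t)) * t = - (g / 2).
    by rewrite /g; field; rewrite gt_eqF.
  by rewrite oppr_ge0 leNgt divr_gt0.
move=> Sk; rewrite leNgt; apply/negP => neg.
have k0 : 0 < k by exact: le_lt_trans S0 Sk.
pose K : set ('rV[R]_n * 'rV[R]_n * R) := closure A `*` closure A `*` `[0, t].
pose B : set ('rV[R]_n * 'rV[R]_n * R) := A `*` A `*` `[0, t].
pose F (z : 'rV[R]_n * 'rV[R]_n * R) := C z.1.1 z.1.2 lambda z.2 + k * z.2.
have sT s : 0 <= s <= t -> 0 <= s < T by move=> /andP[-> st] /=; exact: le_lt_trans st tT.
have sT' s : 0 <= s <= t -> 0 <= s <= T by move=> /sT /andP[-> /ltW].
have cK : compact K.
  by apply: compact_setX; [exact: compact_setX|exact: segment_compact].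
have BK : B `<=` K.
  by move=> z [[z1 z3] z2]; split=> //; split; exact: subset_closure.
have B0 : B (x1, x3, t) by split=> //=; rewrite in_itv/= t0 lexx.
have neg' : F (x1, x3, t) < 0 by [].
have lscF z : K z -> (\forall y \near z, B y -> F (x1, x3, t) < F y) \/
    (B z /\ forall e, 0 < e -> \forall y \near z, B y -> F z - e < F y).
  move: z => [[y1 y3] s] [[/= c1 c3]]; rewrite in_itv/= => sI.
  (* Three cases: lower semicontinuity at interior pairs, then the diagonal of the boundary, and
     finally distinct points of the closure not both in [A]. *)
  have [[Ay1 Ay3]|nA] := pselect (A y1 /\ A y3); [right|left].
    split=> [|e e0]; first by split=> //=; rewrite in_itv.
    have e2 : 0 < e / 2 by rewrite divr_gt0.
    have H := Cstar_lsc oA cA cu up Ay1 Ay3 (sT' _ sI) lI' e2.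
    have ks : k * s - e / 2 < k * s by rewrite gtrBl.
    have ck : k * z.2 @[z --> (y1, y3, s)] --> k * s.
      by apply: cvgMl_tmp; exact: cvg_snd.
    have Hk := ck _ (lt_nbhsr ks).
    near=> z => -[[Az1 Az3]]; rewrite /= in_itv/= => zI.
    have : C y1 y3 lambda s - e / 2 < C z.1.1 z.1.2 lambda z.2.
      by apply: (near H z) => //; exact: sT'.
    have : k * s - e / 2 < k * z.2 by near: z; exact: Hk.
    by rewrite /F/=; lra.
  have [y13|y13] := eqVneq y1 y3.
    subst y3.
    have bp : boundary A y1.
      by split=> //; rewrite ((interior_id A).1 oA) => Ay1; apply: nA.
    have eta0 : 0 < - F (x1, x3, t) by rewrite oppr_gt0.
    have H := Cstar_near_boundary_diagonal oA cA scA cu cD du up ub bp (sT _ sI)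
      (Dub _ _ bp (sT' _ sI)) lI' eta0.
    near=> z => -[[Az1 Az3]]; rewrite /= in_itv/= => /[dup] zI /andP[z0 zt].
    have kz : 0 <= k * z.2 by rewrite mulr_ge0// ltW.
    suff : F (x1, x3, t) < C z.1.1 z.1.2 lambda z.2 by move=> ?; rewrite [ltRHS]/F ltr_wpDr.
    (* The diagonal estimate covers positive times only; at time 0 the log-concavity of the initial
       datum replaces it. *)
    have [z20|z20] := eqVneq z.2 0.
      by rewrite z20; apply: lt_le_trans neg' _; exact: init.
    rewrite -[F _]opprK; apply: (near H z) => //.
    by rewrite lt_neqAle eq_sym z20 z0/= (le_lt_trans zt).
  have A2 : A (lambda *: y3 + (1 - lambda) *: y1) by exact: scA.
  have H := Cstar_near_boundary (F (x1, x3, t)) oA cA cu up ub c1 c3 (sT' _ sI) lI A2 nA.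
  near=> z => -[[Az1 Az3]]; rewrite /= in_itv/= => /[dup] zI /andP[z0 zt].
  have kz : 0 <= k * z.2 by rewrite mulr_ge0// ltW.
  suff : F (x1, x3, t) < C z.1.1 z.1.2 lambda z.2 by move=> ?; rewrite [ltRHS]/F ltr_wpDr.
  by apply: (near H z) => //; exact: sT'.
have [[[y1 y3] s] [[/= Ay1 Ay3]] + zmin] := lsc_compact_min cK BK B0 lscF.
rewrite in_itv/= => /[dup] sI /andP[s0 st].
have Fs : F (y1, y3, s) < 0 by exact: le_lt_trans (zmin _ B0) neg'.
have sn0 : s != 0.
  apply/eqP => s00; move: Fs; rewrite /F s00/= mulr0 addr0 ltNge.
  by move=> /negP; apply; exact: init.
have sp : 0 < s < T by rewrite lt_neqAle eq_sym sn0 s0 (le_lt_trans st).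
have sTT := sT' _ sI.
apply: (@parabolic_min_contradiction R n A T k S a u ut y1 y3 s lambda oA cA sp (u2 _ sp)) => //.
- by move=> x Ax; exact: dut.
- by move=> x Ax; exact: up.
- by move=> x Ax; exact: ueq.
- exact: aS.
- move=> z1 z3 s' Az1 Az3 /andP[s'0 s's]; apply: (zmin (z1, z3, s')); split=> //=.
  by rewrite in_itv/= s'0 (le_trans s's).
Unshelve. all: by end_near. Qed.

(** * Passage to the final time and conclusion *)

Lemma bounded_closure_compact (R : realType) (n : nat) (A : set 'rV[R]_n) :
  bounded_set A -> compact (closure A).
Proof.
move=> [M [Mr MA]]; apply: bounded_closed_compact; last exact: closed_closure.
exists M; split=> // M' MM' x cx /=.
have cB : closed [set y : 'rV[R]_n | `|y| <= M'].
  exact: ((continuous_closedP _).1 (@norm_continuous R 'rV[R]_n) _ (@closed_le R M')).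
by apply: cB; apply: closureS cx => y Ay /=; exact: MA.
Qed.

(** Carries the bound, obtained before [T], to the time [T] itself, where [ut] is only the
    continuous extension of the time derivative. *)
Lemma Cstar_ln_left_cvg (R : realType) (n : nat) (A : set 'rV[R]_n) (T : R)
    (u : 'rV[R]_n -> R -> R) (x1 x3 : 'rV[R]_n) (lambda : R) :
  {within closure A `*` `[0, T], continuous (fun z : 'rV[R]_n * R => u z.1 z.2)} ->
  0 < T -> (forall x, A x -> 0 < u x T) ->
  A x1 -> A x3 -> A (lambda *: x3 + (1 - lambda) *: x1) ->
  Cstar (fun x s => ln (u x s)) x1 x3 lambda s @[s --> T^'-] -->
  Cstar (fun x s => ln (u x s)) x1 x3 lambda T.
Proof.
move=> cu T0 uT A1 A3 A2.
have lnc x : A x -> ln (u x s) @[s --> T^'-] --> ln (u x T).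
  move=> Ax; have cx := subset_closure Ax.
  have cux : {within `[0, T], continuous (u x)} := within_slice_snd (x := x) cu cx.
  have /continuous_within_itvP-/(_ T0)[_ _ cT] := cux.
  exact: cvg_comp cT (continuous_ln (uT _ Ax)).
by apply: cvgB; [apply: cvgB; [|apply: cvgMl_tmp]|apply: cvgMl_tmp]; exact: lnc.
Qed.

Unset Implicit Arguments.

Theorem theorem1p7 (R : realType) (n : nat) (hn : (2 <= n)%N)
    (Omega : set 'rV[R]_n) (alpha : R) (halpha : 0 < alpha < 1)
    (Omega_domain : domain Omega)
    (Omega_bounded : bounded_set Omega)
    (Omega_smooth : C2alpha_boundary alpha Omega)
    (Omega_convex : strongly_convex alpha Omega)
    (nu : 'rV[R]_n -> 'rV[R]_n)
    (nu_normal : forall p : 'rV[R]_n, boundary Omega p ->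
      interior_unit_normal alpha Omega p (nu p))
    (T : R) (T_gt0 : 0 < T)
    (a : 'rV[R]_n -> R -> R)
    (u0 : 'rV[R]_n -> R)
    (u0_C1 : C1_closure Omega u0)
    (u0_boundary : forall x : 'rV[R]_n, boundary Omega x -> u0 x = 0)
    (u : 'rV[R]_n -> R -> R)
    (Du : 'rV[R]_n -> R -> 'rV[R]_n) (ut : 'rV[R]_n -> R -> R)
    (u_C2x : forall t : R, 0 < t <= T -> C2_on Omega (u ^~ t))
    (u_C1 : C1_closed_cylinder Omega T u Du ut)
    (u_gt0 : forall (x : 'rV[R]_n) (t : R), Omega x -> 0 < t <= T -> 0 < u x t)
    (u_eq : forall (x : 'rV[R]_n) (t : R), Omega x -> 0 < t <= T ->
      ut x t - laplacian (u ^~ t) x = a x t * u x t)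
    (u_boundary : forall (x : 'rV[R]_n) (t : R), boundary Omega x -> 0 <= t <= T -> u x t = 0)
    (Du_boundary : forall (x : 'rV[R]_n) (t : R), boundary Omega x -> 0 <= t <= T ->
      0 < dotv (Du x t) (nu x))
    (u_initial : forall x : 'rV[R]_n, closure Omega x -> u x 0 = u0 x)
    (u0_log_concave : log_concave Omega u0) :
  (ereal_inf
     ((fun '(x1, x3, lambda, t) =>
         (Cstar (fun x s => ln (u x s)) x1 x3 lambda t)%:E) @`
      (Omega `*` Omega `*` `[0%R, 1%R] `*` `[0%R, T]))%classic
   >= - (expR 1 * T)%:E *
      ereal_sup
        ((fun '(x1, x3, lambda, t) =>
            (neg_part (Cstar a x1 x3 lambda t))%:E) @`
         (Omega `*` Omega `*` `[0%R, 1%R] `*` `]0%R, T]))%classic)%E.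
Proof.
have [oO _ [x0 Ox0]] := Omega_domain.
have [cu0 _] := u0_C1.
have [cu cD _ du] := u_C1.
have cvxO : convex_set Omega by exact: log_concave_convex oO cu0 u0_boundary u0_log_concave.
have cptO := bounded_closure_compact Omega_bounded.
have scO x y s : closure Omega x -> closure Omega y -> x != y -> 0 < s < 1 ->
    Omega (s *: y + (1 - s) *: x).
  exact: strongly_convex_segment oO Omega_smooth Omega_convex cvxO.
have [u0p u0c] := u0_log_concave.
have up x t : Omega x -> 0 <= t <= T -> 0 < u x t.
  move=> Ox /andP[]; rewrite le_eqVlt => /predU1P[<- _|t0 tT].
    by rewrite u_initial ?u0p//; exact: subset_closure.
  by apply: u_gt0 => //; rewrite t0.
have lT t : 0 < t < T -> 0 < t <= T by move=> /andP[-> /ltW].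
have Ddu y v s : Omega y -> 0 < s < T -> is_derive y v (u ^~ s) (dotv (Du y s) v).
  move=> Oy sT; have [uC1 _] := u_C2x s (lT _ sT).
  have := C1_on_is_derive v oO uC1 Oy.
  suff -> : grad (u ^~ s) y = Du y s by [].
  apply/rowP => i; rewrite mxE /partial.
  by have [/(_ i) dyi _] := du y s Oy sT; rewrite derive_val.
(* For these weights the intermediate point is an endpoint; the minimum principle is applied with
   [0 < lambda < 1]. *)
have Cend x1 x3 lambda s : lambda = 0 \/ lambda = 1 ->
    Cstar (fun x s => ln (u x s)) x1 x3 lambda s = 0.
  case=> ->; rewrite /Cstar.
    by rewrite scale0r add0r subr0 scale1r mul0r mul1r subr0 subrr.
  by rewrite subrr scale1r scale0r addr0 mul0r mul1r subrr subr0.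
set M := ereal_sup _.
have Mge x1 x3 lambda t : Omega x1 -> Omega x3 -> 0 <= lambda <= 1 -> 0 < t <= T ->
    ((neg_part (Cstar a x1 x3 lambda t))%:E <= M)%E.
  move=> O1 O3 lI tI; apply: ereal_sup_ubound; exists (x1, x3, lambda, t) => //.
(* The quadruple [(x0, x0, 0, T)] shows that the supremum runs over a nonempty set of nonnegative
   values. *)
have M0 : (0 <= M)%E.
  have := Mge x0 x0 0 T Ox0 Ox0; rewrite !lexx ler01 T_gt0 => /(_ isT isT) M1.
  apply: le_trans M1.
  by rewrite lee_fin /neg_part le_max lexx.
have eT0 : 0 < expR 1 * T by rewrite mulr_gt0 ?expR_gt0.
have init lambda y1 y3 : 0 <= lambda <= 1 -> Omega y1 -> Omega y3 ->
    0 <= Cstar (fun x s => ln (u x s)) y1 y3 lambda 0.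
  move=> lI O1 O3; have O2 : Omega (lambda *: y3 + (1 - lambda) *: y1).
    exact: ((convex_setP Omega).1 cvxO).
  rewrite /Cstar !u_initial; [|exact: subset_closure..].
  by have := convex_functionE u0c O1 O3 lI; lra.
(* If the supremum is [+oo], the lower bound is [-oo] and nothing remains to prove; the value [-oo]
   contradicts [M0]. *)
clearbody M; case: M M0 Mge => [S M0 Mge|_ _|//]; last first.
  by rewrite lt0_muley ?leNye// -EFinN lte_fin oppr_lt0.
apply: le_ereal_inf_tmp => _ [[[[x1 x3] lambda] t] /= [[[in1 in3] lI] tI] <-].
rewrite in_itv/= in lI; rewrite in_itv/= in tI.
rewrite lee_fin mulNr.
have S0 : 0 <= S by rewrite -lee_fin.
have [l01|l01] := pselect (lambda = 0 \/ lambda = 1).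
  by rewrite Cend// oppr_le0 mulr_ge0// ltW.
have {}l01 : 0 < lambda < 1.
  case/andP: lI => l0 l1; rewrite !lt_neqAle l0 l1 !andbT eq_sym.
  by apply/andP; split; apply/eqP => l; apply: l01; [left|right].
have aS y1 y3 s : Omega y1 -> Omega y3 -> 0 < s < T -> - S <= Cstar a y1 y3 lambda s.
  move=> Oy1 Oy3 sT; have := Mge y1 y3 lambda s Oy1 Oy3 lI (lT _ sT).
  by rewrite lee_fin /neg_part ge_max lerNl => /andP[].
have early s : 0 <= s < T -> - (S * T) <= Cstar (fun x s => ln (u x s)) x1 x3 lambda s.
  move=> sT; apply: (@le_trans _ _ (- (S * s))).
    by rewrite lerN2 ler_wpM2l//; case/andP: sT => _ /ltW.
  apply: (Cstar_ln_ge (a := a) (ut := ut) oO cvxO cptO scO cu cD Ddu) => //.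
  - by move=> y s' Oy s'T; have [] := du y s' Oy s'T.
  - by move=> s' /lT; exact: u_C2x.
  - by move=> y s' Oy /lT; exact: u_eq.
  - exact: Du_boundary.
  - by move=> y1 y3; exact: init.
(* The minimum principle yields the constant 1, and [expR 1] exceeds it. *)
have STe : S * T <= expR 1 * T * S.
  rewrite -mulrA [T * S]mulrC; apply: ler_peMl; first by rewrite mulr_ge0// ltW.
  by rewrite ltW// expR_gt1.
have all t' : 0 <= t' <= T -> - (S * T) <= Cstar (fun x s => ln (u x s)) x1 x3 lambda t'.
  move=> /andP[t0]; rewrite le_eqVlt => /predU1P[->|tT]; last by apply: early; rewrite t0.
  have O2 : Omega (lambda *: x3 + (1 - lambda) *: x1) by exact: ((convex_setP Omega).1 cvxO).
  have uT x : Omega x -> 0 < u x T by move=> Ox; apply: up; rewrite // lexx ltW.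
  apply: (cvgr_to_ge (Cstar_ln_left_cvg cu T_gt0 uT in1 in3 O2)).
  near=> s; apply: early; apply/andP; split; near: s.
    exact: nbhs_left_ge.
  exact: nbhs_left_lt.
by apply: le_trans (all _ tI); rewrite lerN2.
Unshelve. all: by end_near. Qed.
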